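(* Let $X$ be a connected, oriented, non-compact $C^\infty$ Riemannian manifold with volume element $m$. Let $\sigma=\rho\, m$ with $\rho>0$ $m$-a.e., $\rho^{1/2}\in H^{1,2}_{loc}(X)$ and $\rho\notin L^1(X,m)$. Let $\Phi:\Gamma\to\mathbb{R}\cup\{+\infty\}$ be a potential on the configuration space $\Gamma=\Gamma_X$, and let $\mu\in\mathcal{G}^1_{gc}(\sigma,\Phi)$, i.e. $\mu$ is a grand canonical Gibbs measure with intensity $\sigma$ and interaction potential $\Phi$ such that $\int_\Gamma\gamma(K)\,d\mu(\gamma)<\infty$ for every compact $K\subset X$. Then for all smooth cylinder functions $F,G\in\mathcal{F}C_b^\infty(\mathcal{D},\Gamma)$, $$\mathcal{E}^\Gamma_\mu(F,G)=\int_\Gamma\langle\nabla^\Gamma F(\gamma),\nabla^\Gamma G(\gamma)\rangle_{T_\gamma\Gamma}\,d\mu(\gamma)=\int_\Gamma\int_X\langle\nabla^X\nabla^PF(\gamma,x),\nabla^X\nabla^PG(\gamma,x)\rangle_{T_xX}\,e^{-E^\Phi_{\{x\}}(\gamma+\varepsilon_x)}\,d\sigma(x)\,d\mu(\gamma),$$ where $e^{-\infty}:=0$ and $\nabla^X$ acts on the variable $x$.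
   Context: **Manifold and configuration space.** $H^{1,2}_{loc}(X)$ is the local Sobolev space of order 1 in $L^2(X,m)$. $\langle\cdot,\cdot\rangle_{T_xX}$ is the Riemannian inner product and $\nabla^X$ the gradient on $X$. $\mathcal{O}_c(X)$ and $\mathcal{B}_c(X)$ are the open, respectively Borel, subsets of $X$ with compact closure. $\Gamma:=\Gamma_X:=\{\gamma\subset X: |\gamma\cap K|<\infty\text{ for every compact }K\subset X\}$. A configuration $\gamma$ is identified with the measure $\sum_{x\in\gamma}\varepsilon_x$ ($\varepsilon_x$ = Dirac measure at $x$). Write $\langle\gamma,\varphi\rangle=\langle\varphi,\gamma\rangle=\sum_{x\in\gamma}\varphi(x)$ and $\gamma_\Lambda:=\gamma\cap\Lambda$. $\Gamma$ carries the vague topology and its Borel $\sigma$-algebra $\mathcal{B}(\Gamma)$. For $B\in\mathcal{B}(X)$, $N_B(\gamma):=\gamma(B)$. For $A\in\mathcal{B}(X)$, $\mathcal{B}_A(\Gamma):=\sigma(\{N_B: B\in\mathcal{B}_c(X), B\subset A\})$. **Poisson measure.** $\pi_\sigma$ is the probability measure on $(\Gamma,\mathcal{B}(\Gamma))$ with $\int_\Gamma e^{\langle\gamma,\varphi\rangle}d\pi_\sigma(\gamma)=\exp\big(\int_X(e^{\varphi(x)}-1)\,d\sigma(x)\big)$ for all real-valued continuous compactly supported $\varphi$ on $X$. **Potentials and conditional energy.** A potential is a function $\Phi:\Gamma\to\mathbb{R}\cup\{+\infty\}$ with $\Phi(\emptyset)=0$, $\Phi=1_{\{N_X<\infty\}}\Phi$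 (so $\Phi$ vanishes on infinite configurations), and $\gamma\mapsto\Phi(\gamma_\Lambda)$ is $\mathcal{B}_\Lambda(\Gamma)$-measurable for every $\Lambda\in\mathcal{B}_c(X)$. For $\Lambda\in\mathcal{B}_c(X)$ the conditional energy is $$E^\Phi_\Lambda(\gamma):=\sum_{\gamma'\subset\gamma,\ \gamma'(\Lambda)>0}\Phi(\gamma')\quad\text{if }\sum_{\gamma'\subset\gamma,\ \gamma'(\Lambda)>0}|\Phi(\gamma')|<\infty,\qquad E^\Phi_\Lambda(\gamma):=+\infty\text{ otherwise},$$ with empty sums equal to zero. $E^\Phi_{\{x\}}$ is the case $\Lambda=\{x\}$. **Gibbs measures.** For $\Lambda\in\mathcal{O}_c(X)$, $\gamma\in\Gamma$, $\Delta\in\mathcal{B}(\Gamma)$ let $$Z^{\sigma,\Phi}_\Lambda(\gamma):=\int_\Gamma\exp[-E^\Phi_\Lambda(\gamma_{X\setminus\Lambda}+\gamma'_\Lambda)]\,d\pi_\sigma(\gamma'),$$ $$\Pi^{\sigma,\Phi}_\Lambda(\gamma,\Delta):=1_{\{Z^{\sigma,\Phi}_\Lambda<\infty\}}(\gamma)\,[Z^{\sigma,\Phi}_\Lambda(\gamma)]^{-1}\int_\Gamma1_\Delta(\gamma_{X\setminus\Lambda}+\gamma'_\Lambda)\exp[-E^\Phi_\Lambda(\gamma_{X\setminus\Lambda}+\gamma'_\Lambda)]\,d\pi_\sigma(\gamma').$$ A probability measure $\mu$ on $(\Gamma,\mathcal{B}(\Gamma))$ is a grand canonical Gibbs measure with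 interaction potential $\Phi$, written $\mu\in\mathcal{G}_{gc}(\sigma,\Phi)$, if $\int_\Gamma\Pi^{\sigma,\Phi}_\Lambda(\gamma,\Delta)\,d\mu(\gamma)=\mu(\Delta)$ for all $\Lambda\in\mathcal{O}_c(X)$, $\Delta\in\mathcal{B}(\Gamma)$. $\mathcal{G}^1_{gc}(\sigma,\Phi)$ is the set of $\mu\in\mathcal{G}_{gc}(\sigma,\Phi)$ with $\int_\Gamma\gamma(K)\,d\mu(\gamma)<\infty$ for all compact $K\subset X$. **Cylinder functions and gradients.** $\mathcal{D}:=C_0^\infty(X)$ (smooth, compactly supported, real-valued). $\mathcal{F}C_b^\infty(\mathcal{D},\Gamma)$ is the set of functions $F(\gamma)=g_F(\langle\gamma,\varphi_1\rangle,\dots,\langle\gamma,\varphi_N\rangle)$ with $N\in\mathbb{N}$, $\varphi_1,\dots,\varphi_N\in\mathcal{D}$, $g_F\in C_b^\infty(\mathbb{R}^N)$ (smooth, bounded together with all partial derivatives). The tangent space at $\gamma$ is $T_\gamma\Gamma:=L^2(X\to TX;\gamma)$, the space of $\gamma$-square-integrable sections of $TX$, with $\langle V^1,V^2\rangle_{T_\gamma\Gamma}=\int_X\langle V^1(x),V^2(x)\rangle_{T_xX}\,d\gamma(x)$. The intrinsic gradient is $$(\nabla^\Gamma F)(\gamma;x)=\sum_{i=1}^N\frac{\partial g_F}{\partial s_i}(\langle\gamma,\varphi_1\rangle,\dots,\langle\gamma,\varphi_N\rangle)\,\nabla^X\varphi_i(x).$$ The Poissonian gradient is $(\nabla^PF)(\gamma,x):=F(\gamma+\varepsilon_x)-F(\gamma)$,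 $\gamma\in\Gamma$, $x\in X$ (for fixed $\gamma$, the points $x\in\gamma$ form a $\sigma$-null set, so they play no role in integrals with respect to $\sigma$). The intrinsic pre-Dirichlet form is $\mathcal{E}^\Gamma_\mu(F,G):=\int_\Gamma\langle\nabla^\Gamma F(\gamma),\nabla^\Gamma G(\gamma)\rangle_{T_\gamma\Gamma}\,d\mu(\gamma)$. *)

(* Defs.v *)
From HB Require Import structures.
From mathcomp Require Import all_boot all_order all_algebra.
From mathcomp Require Import all_classical all_reals all_analysis.
From mathcomp Require Import measurable_realfun.

Set Implicit Arguments.
Unset Strict Implicit.
Unset Printing Implicit Defensive.
Import Order.TTheory GRing.Theory Num.Theory.
Import numFieldNormedType.Exports.

Local Open Scope classical_set_scope.
Local Open Scope ring_scope.

Notation borel T := (g_sigma_algebraType (@open T)).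

Section topology.
Context {R : realType} {T : topologicalType}.

Definition compact_support (f : T -> R) := compact (closure [set x | f x != 0]).

Definition relatively_compact (A : set T) := compact (closure A).

End topology.

Section euclidean.
Context {R : realType}.

Definition partial n (j : 'I_n) (f : 'rV[R]_n -> R) : 'rV[R]_n -> R :=
  fun y => 'D_(delta_mx 0 j) f y.

Definition partials n (s : seq 'I_n) (f : 'rV[R]_n -> R) : 'rV[R]_n -> R :=
  foldr (@partial n) f s.

(* Meant for open [U]: the partial derivatives at points of [U] then depend on
   the values of [f] on [U] only. *)
Definition smooth_on n (U : set 'rV[R]_n) (f : 'rV[R]_n -> R) :=
  forall (s : seq 'I_n) y, U y ->
    {for y, continuous (partials s f)} /\
    forall j, derivable (partials s f) y (delta_mx 0 j).

Definition Cb_smooth n (g : 'rV[R]_n -> R) :=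
  smooth_on setT g /\
  forall s : seq 'I_n, exists C : R, forall y, `|partials s g y| <= C.

Definition Cc_smooth n (O : set 'rV[R]_n) (f : 'rV[R]_n -> R) :=
  [/\ smooth_on setT f, compact_support f & closure [set y | f y != 0] `<=` O].

Local Open Scope ereal_scope.

Definition is_lebesgue n (lam : {measure set (borel 'rV[R]_n) -> \bar R}) :=
  forall a b : 'rV[R]_n, (forall i, (a 0 i <= b 0 i)%R) ->
    lam [set y | forall i, (a 0 i <= y 0 i <= b 0 i)%R] =
    (\prod_i (b 0 i - a 0 i))%:E.

Context {n : nat} (lam : {measure set (borel 'rV[R]_n) -> \bar R}).

Definition L2_loc (O : set 'rV[R]_n) (u : 'rV[R]_n -> R) :=
  measurable_fun (O : set (borel 'rV[R]_n)) u /\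
  forall K, compact K -> K `<=` O -> \int[lam]_(y in K) (u y ^+ 2)%:E < +oo.

Definition weak_partial (O : set 'rV[R]_n) (j : 'I_n) (u v : 'rV[R]_n -> R) :=
  forall psi, Cc_smooth O psi ->
    \int[lam]_(y in O) (u y * partial j psi y)%:E =
    - \int[lam]_(y in O) (v y * psi y)%:E.

End euclidean.

Record chart (R : realType) (X : topologicalType) (d : nat) := Chart {
  cdom : set X;
  crange : set 'rV[R]_d;
  cmap : X -> 'rV[R]_d;
  cinv : 'rV[R]_d -> X;
  cdom_open : open cdom;
  crange_open : open crange;
  cmap_range : forall x, cdom x -> crange (cmap x);
  cinv_dom : forall y, crange y -> cdom (cinv y);
  cmapK : forall x, cdom x -> cinv (cmap x) = x;
  cinvK : forall y, crange y -> cmap (cinv y) = y;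
  cmap_continuous : forall x, cdom x -> {for x, continuous cmap};
  cinv_continuous : forall y, crange y -> {for y, continuous cinv} }.

Section transition.
Context {R : realType} {X : topologicalType} {d : nat}.
Implicit Types c : chart R X d.

Definition overlap c (c' : chart R X d) : set 'rV[R]_d := crange c `&` cinv c @^-1` cdom c'.

Definition transition c (c' : chart R X d) : 'rV[R]_d -> 'rV[R]_d := cmap c' \o cinv c.

End transition.

(* The orientation is given by an atlas whose transition maps have positive
   Jacobian determinant.  [metric i y] is the Gram matrix of the Riemannian
   metric at the point of coordinates [y] in the chart [i]; with the
   row-vector convention, the differential of [f] at [y] sends [v] to
   [v *m 'J f y]. *)
Record oriented_riemannian (R : realType) (X : topologicalType) (d : nat) :=
  OrientedRiemannian {
  manifold_hausdorff : hausdorff_space X;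
  manifold_second_countable : @second_countable X;
  atlas : Type;
  achart :> atlas -> chart R X d;
  atlas_cover : forall x, exists i, cdom (achart i) x;
  atlas_smooth : forall i j k,
    smooth_on (overlap (achart i) (achart j))
      (fun y => transition (achart i) (achart j) y 0 k);
  atlas_oriented : forall i j y, overlap (achart i) (achart j) y ->
    0 < \det ('J (transition (achart i) (achart j)) y);
  metric : atlas -> 'rV[R]_d -> 'M[R]_d;
  metric_smooth : forall i k l,
    smooth_on (crange (achart i)) (fun y => metric i y k l);
  metric_sym : forall i y, crange (achart i) y -> (metric i y)^T = metric i y;
  metric_posdef : forall i y, crange (achart i) y ->
    forall v : 'rV[R]_d, v != 0 -> 0 < (v *m metric i y *m v^T) 0 0;
  metric_compat : forall i j y, overlap (achart i) (achart j) y ->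
    let J := 'J (transition (achart i) (achart j)) y in
    metric i y = J *m metric j (transition (achart i) (achart j) y) *m J^T }.

Section riemannian.
Context {R : realType} {X : ptopologicalType} {d : nat}.
Variable M : oriented_riemannian R X d.

Definition chart_at (x : X) : atlas M := projT1 (cid (atlas_cover M x)).

(* A tangent vector at [x] is represented by its coordinates in the chart
   [chart_at x]. *)
Definition tangent (x : X) : Type := 'rV[R]_d.

Definition metric_at (x : X) : 'M[R]_d :=
  metric (chart_at x) (cmap (M (chart_at x)) x).

Definition tangent_inner (x : X) (v w : tangent x) : R :=
  (v *m metric_at x *m w^T) 0 0.

Definition gradient (f : X -> R) (x : X) : tangent x :=
  (\row_j partial j (f \o cinv (M (chart_at x))) (cmap (M (chart_at x)) x))
  *m invmx (metric_at x).

Definition smooth (f : X -> R) :=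
  forall i, smooth_on (crange (M i)) (f \o cinv (M i)).

Definition test_function (f : X -> R) := smooth f /\ compact_support f.

Variable lam : {measure set (borel 'rV[R]_d) -> \bar R}.

Definition is_volume (m : {measure set (borel X) -> \bar R}) :=
  forall i (A : set (borel X)), measurable A -> A `<=` cdom (M i) ->
    m A = (\int[lam]_(y in crange (M i) `&` cinv (M i) @^-1` A)
             (Num.sqrt (\det (metric i y)))%:E)%E.

Definition H12_loc (f : X -> R) :=
  measurable_fun setT (f : borel X -> R) /\
  forall i, L2_loc lam (crange (M i)) (f \o cinv (M i)) /\
    forall j, exists2 h, L2_loc lam (crange (M i)) h &
      weak_partial lam (crange (M i)) j (f \o cinv (M i)) h.

End riemannian.

Definition locally_finite (X : topologicalType) (A : set X) :=
  forall K, compact K -> finite_set (A `&` K).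

(* The parameter [R] only serves to define the vague topology. *)
Record configuration (R : realType) (X : ptopologicalType) := Configuration {
  points :> set X;
  points_lf : locally_finite points }.

Section configuration_operations.
Context {R : realType} {X : ptopologicalType}.
Implicit Types gamma : configuration R X.

Lemma configuration0_subproof : locally_finite (@set0 X).
Proof. by move=> K _; rewrite set0I; exact: finite_set0. Qed.
Definition configuration0 : configuration R X :=
  Configuration R configuration0_subproof.

Lemma crestrict_subproof gamma A : locally_finite (gamma `&` A).
Proof.
by move=> K /(points_lf gamma); apply: sub_finite_set => x [[? _] ?]; split.
Qed.
Definition crestrict gamma (A : set X) : configuration R X :=
  Configuration R (@crestrict_subproof gamma A).

Lemma cunion_subproof gamma gamma' : locally_finite (gamma `|` gamma').
Proof.
by move=> K cK; rewrite setIUl finite_setU; split; exact: points_lf.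
Qed.
Definition cunion gamma gamma' : configuration R X :=
  Configuration R (@cunion_subproof gamma gamma').

Lemma csingle_subproof (x : X) : locally_finite [set x].
Proof. by move=> K _; apply: (sub_finite_set _ (finite_set1 x)) => ? []. Qed.
Definition csingle (x : X) : configuration R X :=
  Configuration R (@csingle_subproof x).

(* Adding to [gamma] a point of [gamma] leaves it unchanged. *)
Definition add_point gamma (x : X) := cunion gamma (csingle x).

(* The sum is finite as soon as [f] vanishes outside a compact set; it is 0 by
   convention if [f] is nonzero at infinitely many points of [gamma]. *)
Definition pairing gamma (f : X -> R) : R := \sum_(x \in points gamma) f x.

Definition counting_on gamma : set (borel X) -> \bar R :=
  fun B => counting (points gamma `&` B).

Let discrete := g_sigma_algebraType [set: set X].

Let counting_on0 gamma : counting_on gamma set0 = 0%E.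
Proof. by rewrite /counting_on setI0; exact: (@measure0 _ discrete). Qed.

Let counting_on_ge0 gamma B : (0 <= counting_on gamma B)%E.
Proof. exact: (@measure_ge0 _ discrete). Qed.

Let counting_on_sigma_additive gamma : semi_sigma_additive (counting_on gamma).
Proof.
have md (A : set discrete) : measurable A by exact: sub_sigma_algebra.
move=> F _ tF _; rewrite /counting_on setI_bigcupr.
apply: (@measure_semi_sigma_additive _ discrete) => //.
exact: trivIset_setIl.
Qed.

HB.instance Definition _ gamma := isMeasure.Build _ _ _ (counting_on gamma)
  (counting_on0 gamma) (counting_on_ge0 gamma)
  (@counting_on_sigma_additive gamma).

Definition config_measure gamma : {measure set (borel X) -> \bar R} :=
  counting_on gamma.

End configuration_operations.

HB.instance Definition _ R X := gen_eqMixin (configuration R X).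
HB.instance Definition _ R X := gen_choiceMixin (configuration R X).
HB.instance Definition _ R X := isPointed.Build (configuration R X)
  configuration0.

Record Cc (R : realType) (X : topologicalType) := CcFun {
  Cc_fun :> X -> R;
  Cc_continuous : continuous Cc_fun;
  Cc_compact_support : compact_support Cc_fun }.

Definition pairing_Cc (R : realType) (X : ptopologicalType)
    (gamma : configuration R X) : {ptws Cc R X -> R} :=
  fun f => pairing gamma f.

(* The vague topology is the coarsest one making all the maps
   [gamma |-> pairing gamma f], [f : Cc R X], continuous. *)
HB.instance Definition _ (R : realType) (X : ptopologicalType) :=
  Topological.copy (configuration R X)
    (initial_topology (@pairing_Cc R X)).

Notation Gamma R X := (borel (configuration R X)).

Section gibbs.
Context {R : realType} {X : ptopologicalType}.
Implicit Types (gamma : configuration R X) (B Lam : set (borel X)).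
Local Open Scope ereal_scope.

Definition Oc (Lam : set X) := open Lam /\ relatively_compact Lam.

Definition Bc (Lam : set (borel X)) :=
  measurable Lam /\ relatively_compact (Lam : set X).

Definition N_in B gamma : \bar R := config_measure gamma B.

Definition B_Gamma (A : set (borel X)) : set (set (configuration R X)) :=
  <<s \bigcup_(B in [set B | Bc B /\ B `<=` A])
        preimage_set_system setT (N_in B) measurable >>.

Definition is_poisson (sigma : {measure set (borel X) -> \bar R})
    (P : probability (Gamma R X) R) :=
  forall phi : Cc R X,
    \int[P]_gamma (expR (pairing gamma phi))%:E =
    expeR (\int[sigma]_x (expR (phi x) - 1)%:E).

Definition is_potential (Phi : configuration R X -> \bar R) :=
  [/\ forall gamma, Phi gamma <> -oo,
      Phi configuration0 = 0,
      forall gamma, infinite_set gamma -> Phi gamma = 0 &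
      forall Lam, Bc Lam -> forall Y : set (\bar R), measurable Y ->
        B_Gamma Lam ((fun gamma => Phi (crestrict gamma Lam)) @^-1` Y)].

Section energy.
Variable Phi : configuration R X -> \bar R.

Definition hitting_subconfigs Lam gamma : set (configuration R X) :=
  [set gamma' : configuration R X | gamma' `<=` gamma /\ 0 < N_in Lam gamma'].

Definition energy Lam gamma : \bar R :=
  if `[< summable (hitting_subconfigs Lam gamma) Phi >] then
    \esum_(gamma' in hitting_subconfigs Lam gamma) Phi^\+ gamma' -
    \esum_(gamma' in hitting_subconfigs Lam gamma) Phi^\- gamma'
  else +oo.

Variable P : probability (Gamma R X) R.

Definition splice Lam gamma gamma' : configuration R X :=
  cunion (crestrict gamma (~` Lam)) (crestrict gamma' Lam).

Definition partition_function Lam gamma : \bar R :=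
  \int[P]_gamma' expeR (- energy Lam (splice Lam gamma gamma')).

Definition specification Lam gamma (Delta : set (configuration R X)) : \bar R :=
  (\1_[set eta | (partition_function Lam eta < +oo)%E] gamma *
    (fine (partition_function Lam gamma))^-1)%:E *
  \int[P]_gamma' ((\1_Delta (splice Lam gamma gamma'))%:E *
                  expeR (- energy Lam (splice Lam gamma gamma'))).

Definition gibbs (mu : probability (Gamma R X) R) :=
  forall Lam, Oc Lam -> forall Delta : set (Gamma R X), measurable Delta ->
    \int[mu]_gamma specification Lam gamma Delta = mu Delta.

Definition gibbs1 (mu : probability (Gamma R X) R) :=
  gibbs mu /\
  forall K, compact K -> \int[mu]_gamma config_measure gamma K < +oo.

End energy.

End gibbs.

(* A cylinder function together with a representation of it, from which its
   intrinsic gradient is computed. *)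
Record cylinder (R : realType) (X : ptopologicalType) (d : nat)
    (M : oriented_riemannian R X d) := Cylinder {
  cyl_size : nat;
  cyl_phi : 'I_cyl_size -> X -> R;
  cyl_phi_test : forall i, test_function M (cyl_phi i);
  cyl_g : 'rV[R]_cyl_size -> R;
  cyl_g_smooth : Cb_smooth cyl_g }.

Section cylinder_functions.
Context {R : realType} {X : ptopologicalType} {d : nat}.
Context {M : oriented_riemannian R X d}.
Implicit Types (F G : cylinder M) (gamma : configuration R X).

Definition cyl_coord F gamma : 'rV[R]_(cyl_size F) :=
  \row_i pairing gamma (cyl_phi i).

Definition cyl_fun F gamma : R := cyl_g (cyl_coord F gamma).

Definition intrinsic_gradient F gamma (x : X) : tangent (R:=R) (d:=d) x :=
  \sum_(i < cyl_size F)
    partial i (@cyl_g _ _ _ _ F) (cyl_coord F gamma) *: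
    (gradient M (cyl_phi i) x : 'rV[R]_d).

Definition poisson_gradient (f : configuration R X -> R) gamma (x : X) : R :=
  f (add_point gamma x) - f gamma.

Definition config_tangent_inner gamma
    (V W : forall x : X, tangent (R:=R) (d:=d) x) : \bar R :=
  (\int[config_measure gamma]_x (tangent_inner M (V x) (W x))%:E)%E.

Definition intrinsic_form (mu : probability (Gamma R X) R) F G : \bar R :=
  (\int[mu]_gamma config_tangent_inner gamma
     (intrinsic_gradient F gamma) (intrinsic_gradient G gamma))%E.

End cylinder_functions.

(* Main.v *)
Require Import Defs.
From HB Require Import structures.
From mathcomp Require Import finmap.
From mathcomp Require Import all_boot all_order all_algebra perm.
From mathcomp Require Import all_classical all_reals all_analysis.
From mathcomp Require Import measurable_realfun.
From mathcomp Require Import lra.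

(** Both sides integrate the same function h(γ, x), the Riemannian inner product at
x of the intrinsic gradients of F and G at γ: the left side integrates it over
the points x of γ, and the right side over an extra point x added to γ, with
the Boltzmann factor of x as a weight.

For x outside γ, the map F(γ + ε_z) - F(γ) of z near x is g_F composed with the
functions <γ, φ_i> + φ_i(z), so the chain rule gives
∇^X ∇^P F (γ, x) = ∇^Γ F (γ + ε_x; x) ([gradient_poisson_gradient]).  The
integrand on the right is thus h(γ + ε_x, x) exp(- E_{x}(γ + ε_x)), and the
theorem is the Georgii-Nguyen-Zessin identity [gnz] for h.

That identity says that, for h >= 0 supported by a bounded open Λ,
∫ Σ_{x in γ} h(γ, x) dμ = ∫∫ h(γ + ε_x, x) exp(- E_{x}(γ + ε_x)) dσ(x) dμ.
By the DLR equation ([dlr]) the points of γ in Λ may be resampled from the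
Poisson measure with a density proportional to exp(- E_Λ); the Mecke formula
[mecke] of the Poisson measure trades the sum over these points for an integral
over σ; and the extra point x multiplies the Boltzmann factor exp(- E_Λ) by
exp(- E_{x}(γ + ε_x)), because a finite subconfiguration of γ + ε_x hitting Λ
either contains x or is a subconfiguration of γ hitting Λ
([boltzmann_add_point]).

For signed h one subtracts the identities for its positive and negative parts.
Both are integrable: h is bounded and vanishes unless x is in a fixed compact
set K, and ∫ γ(K) dμ is finite.

The Mecke formula follows from the Laplace functional, which determines the
probabilities of the void events {γ : γ has no point in U}.  Letting a test
function degenerate gives E[1_{γ(A) = 0} (1 - s)^γ(B)] =
exp(- σ(A) - s σ(B \ A)), and differentiating at s = 0 gives
E[1_{γ(A) = 0} γ(B)] = σ(B \ A) P(γ(A) = 0): this is the Mecke formula for the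
indicator of {γ(A) = 0} x B, and these rectangles form a generating π-system.

All this takes place on the σ-algebra generated by the void events of cozero
sets of compactly supported continuous functions; it is contained in the Borel
σ-algebra of the vague topology.  The points of a configuration can be
enumerated measurably for it ([isolated_point]), so that sums over γ are
countable sums of measurable functions; and its finite subconfigurations are
its traces on countably many open sets ([carves]), so that the same holds for
the conditional energies. *)

Set Implicit Arguments.
Unset Strict Implicit.
Unset Printing Implicit Defensive.
Import Order.TTheory GRing.Theory Num.Theory.
Import numFieldNormedType.Exports.

Local Open Scope classical_set_scope.
Local Open Scope ring_scope.

(** * Calculus in several real variables *)

Section big_limits.
Context {R : realType} {T : Type} {F : set_system T} {FF : Filter F}.
Context {I : Type} (s : seq I) (u : I -> T -> R) (l : I -> R).
Hypothesis ul : forall i, u i @ F --> l i.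

Lemma cvg_sumr : (fun t => \sum_(i <- s) u i t) @ F --> \sum_(i <- s) l i.
Proof.
elim: s => [|i r IH].
  by under eq_fun do rewrite big_nil; rewrite big_nil; exact: cvg_cst.
by under eq_fun do rewrite big_cons; rewrite big_cons; exact: cvgD.
Qed.

Lemma cvg_prodr : (fun t => \prod_(i <- s) u i t) @ F --> \prod_(i <- s) l i.
Proof.
elim: s => [|i r IH].
  by under eq_fun do rewrite big_nil; rewrite big_nil; exact: cvg_cst.
by under eq_fun do rewrite big_cons; rewrite big_cons; exact: cvgM.
Qed.

End big_limits.

Section continuously_differentiable.
Context {R : realType}.

Lemma normr_coord n (v : 'rV[R]_n) i : `|v 0 i| <= `|v|.
Proof.
rewrite [leRHS]/Num.Def.normr/= mx_normrE.
exact: (le_bigmax _ (fun ij : 'I_1 * 'I_n => `|v ij.1 ij.2|) (0, i)).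
Qed.

Lemma normr_rV_le n (v : 'rV[R]_n) c : 0 <= c -> (forall i, `|v 0 i| <= c) ->
  `|v| <= c.
Proof.
move=> c0 h; rewrite [leLHS]/Num.Def.normr/= mx_normrE;
  apply: bigmax_le => // -[i j] _ /=.
by rewrite ord1.
Qed.

Section line.
Variables (V : normedModType R) (f : V -> R) (b v : V).
Let phi (t : R) := f (t *: v + b).

Let quotientE t : (fun h : R => h^-1 *: ((phi \o shift t) (h *: (1 : R)) - phi t)) =
  (fun h => h^-1 *: ((f \o shift (t *: v + b)) (h *: v) - f (t *: v + b))).
Proof.
apply/funext => h; rewrite /phi /=; congr (_ *: (f _ - _)).
by rewrite [h *: (1 : R)]mulr1 scalerDl addrA.
Qed.

Lemma is_derive_line t : derivable f (t *: v + b) v ->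
  is_derive t (1 : R) phi ('D_v f (t *: v + b)).
Proof.
move=> df; apply: DeriveDef; first by rewrite /derivable quotientE.
by rewrite /derive quotientE.
Qed.

(** The bound on [t] is in terms of [`|s|] so that the sign of [s] does not matter:
steps along coordinate axes go both ways. *)
Lemma MVT_line s : (forall t, `|t| <= `|s| -> derivable f (t *: v + b) v) ->
  exists2 t, `|t| <= `|s| & f (s *: v + b) - f b = s * 'D_v f (t *: v + b).
Proof.
move=> df.
have pd t : `|t| <= `|s| -> is_derive t (1 : R) phi ('D_v f (t *: v + b)).
  by move=> /df; exact: is_derive_line.
have pc t : `|t| <= `|s| -> {for t, continuous phi}.
  move=> /pd h; apply: differentiable_continuous; apply/derivable1_diffP.
  exact: ex_derive.
have phi0 : phi 0 = f b by rewrite /phi scale0r add0r.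
have [s0|s0] := leP 0 s.
  have bnd t : t \in `[0, s]%R -> `|t| <= `|s|.
    by rewrite in_itv /= => /andP[t0 ts]; rewrite !ger0_norm.
  have [|t ts E] := MVT_segment s0
      (fun t ts => pd t (bnd t (subset_itv_oo_cc ts))).
    apply: continuous_in_subspaceT => t; rewrite inE /= => ts.
    by apply: pc; apply: bnd.
  exists t; first exact: bnd.
  by rewrite -phi0 -/(phi s) E subr0 mulrC.
have bnd t : t \in `[s, 0]%R -> `|t| <= `|s|.
  by rewrite in_itv /= => /andP[st t0]; rewrite !ler0_norm ?lerN2// ltW.
have [|t ts E] := MVT_segment (ltW s0)
    (fun t ts => pd t (bnd t (subset_itv_oo_cc ts))).
  apply: continuous_in_subspaceT => t; rewrite inE /= => ts.
  by apply: pc; apply: bnd.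
exists t; first exact: bnd.
by rewrite -phi0 -/(phi s) -opprB E sub0r mulrN opprK mulrC.
Qed.

End line.

Section C1.
Variables (n : nat) (f : 'rV[R]_n -> R) (a : 'rV[R]_n).
Hypothesis df : \forall y \near a, forall i, derivable f y (delta_mx 0 i).
Hypothesis cf : forall i, {for a, continuous (partial i f)}.

Let D (v : 'rV[R]_n) : R := \sum_i v 0 i * partial i f a.

Let D_linear : linear D.
Proof.
move=> k u v; rewrite /D scaler_sumr -big_split /=; apply: eq_bigr => i _.
by rewrite !mxE mulrDl [_ *: _]mulrA.
Qed.

Let Dlin : {linear 'rV[R]_n -> R} :=
  HB.pack D (GRing.isLinear.Build _ _ _ _ D D_linear).

Let D_continuous : continuous Dlin.
Proof.
move=> v; rewrite /continuous_at /= /D.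
apply: (@cvg_sumr R _ (nbhs v) _ _ _ (fun i w => w 0 i * partial i f a)) => i.
apply: (@cvgM R _ (nbhs v) _ (fun w => w 0 i) (cst (partial i f a))).
  exact: coord_continuous.
exact: cvg_cst.
Qed.

(* The point reached from 0 after [k] of the coordinate steps towards [h]. *)
Let stair (h : 'rV[R]_n) (k : nat) : 'rV[R]_n :=
  \row_(j < n) if (j < k)%N then h 0 j else 0.

Let stairS h (k : 'I_n) : stair h k.+1 = h 0 k *: delta_mx 0 k + stair h k.
Proof.
apply/rowP => j; rewrite !mxE /= ltnS leq_eqVlt.
have [jk|jk] := eqVneq j k; first by rewrite jk eqxx/= ltnn mulr1 addr0.
by rewrite -val_eqE in jk; rewrite (negbTE jk)/= mulr0 add0r.
Qed.

(** The increment of [f] is split into increments along the coordinate axes; the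
mean value theorem turns each into a partial derivative at a point near [a],
and continuity at [a] replaces that point by [a]. *)
Lemma C1_differentiable : differentiable f a.
Proof.
suff dxf : (f : 'rV[R]_n -> R^o) \o shift a = cst (f a : R^o) +
  (Dlin : 'rV[R]_n -> R^o) +o_ (0 : 'rV[R]_n) id.
  have E := @diff_unique R 'rV[R]_n R^o f Dlin a D_continuous dxf.
  by apply/diff_locallyP; rewrite E.
apply/eqaddoP => _/posnumP[e].
(* One share of [e] for each of the [n] steps; [n.+1] keeps [n = 0] harmless. *)
pose c := e%:num / n.+1%:R.
have c0 : 0 < c by rewrite divr_gt0.
have : \forall y \near a, forall i, derivable f y (delta_mx 0 i) /\
    `|partial i f a - partial i f y| <= c.
  near=> y; move=> i; split; first by move: i; near: y.
  move: i; near: y; apply: filter_forall => i.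
  by have /cvgrPdist_le := @cf i; apply.
move=> /nbhs_ballP[r /= r0 Hr].
near=> h.
have hr : `|h| < r.
  near: h; apply/nbhs_ballP; exists r => //= h.
  by rewrite -ball_normE /= sub0r normrN.
have step (k : 'I_n) : `|f (stair h k.+1 + a) - f (stair h k + a) - h 0 k *
  partial k f a| <= c * `|h|.
  have near_a t : `|t| <= `|h 0 k| -> ball a r
    (t *: delta_mx 0 k + (stair h k + a)).
    move=> th; rewrite -ball_normE /= addrA opprD addrCA subrr addr0 normrN.
    apply: le_lt_trans hr; apply: normr_rV_le => // j; rewrite !mxE /=.
    have [->|jk] := eqVneq j k.
      by rewrite ltnn addr0 mulr1 (le_trans th)// normr_coord.
    by rewrite mulr0 add0r; case: ifP => _; rewrite ?normr0 ?normr_coord.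
  have [t th|t th E] := @MVT_line _ f (stair h k + a) (delta_mx 0 k) (h 0 k).
    by have [] := Hr _ (near_a t th) k.
  rewrite stairS -(addrA (_ *: _)) E -mulrBr normrM mulrC distrC.
  apply: ler_pM => //; last exact: normr_coord.
  by have [] := Hr _ (near_a t th) k.
have tele : f (h + a) - f a = \sum_(k < n)
  (f (stair h k.+1 + a) - f (stair h k + a)).
  rewrite -(big_mkord xpredT (fun k => f (stair h k.+1 + a) - f (stair h k + a))).
  rewrite telescope_sumr//; congr (f (_ + _) - f _).
    by apply/rowP => j; rewrite mxE ltn_ord.
  by rewrite -[LHS]add0r; congr (_ + _); apply/rowP => j; rewrite !mxE.
rewrite /= opprD addrA; rewrite [X in `|X|](_ : _ = f (h + a) - f a - D h)//.
rewrite tele /D -sumrB (le_trans (ler_norm_sum _ _ _))//.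
apply: (@le_trans _ _ (\sum_(k < n) c * `|h|)); first exact: ler_sum.
rewrite sumr_const card_ord -mulrnAl ler_wpM2r//.
rewrite /c -mulr_natr mulrAC ler_pdivrMr// ler_wpM2l// ler_nat//.
Unshelve. all: by end_near. Qed.

End C1.

End continuously_differentiable.

Section chain_rule.
Context {R : realType} {V : normedModType R} {n : nat}.

Lemma differentiable_rV (u : V -> 'rV[R]_n) a :
  (forall i, differentiable (fun x => u x 0 i) a) -> differentiable u a.
Proof.
move=> du; have -> : u = \sum_(i < n) (fun x => u x 0 i *:
  (delta_mx 0 i : 'rV[R]_n)).
  by apply/funext => x; rewrite fct_sumE; exact: row_sum_delta.
apply: differentiable_sum => i; exact: differentiableZl.
Qed.

Lemma derive_comp_rV (g : 'rV[R]_n -> R) (u : V -> 'rV[R]_n) a v :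
  (forall i, differentiable (fun x => u x 0 i) a) -> differentiable g (u a) ->
  'D_v (fun x => g (u x)) a =
  \sum_i 'D_v (fun x => u x 0 i) a * partial i g (u a).
Proof.
move=> du dg; have dua := differentiable_rV du.
have dgu : differentiable (g \o u) a by exact: differentiable_comp.
rewrite -[LHS]/('D_v (g \o u) a) deriveE// diff_comp//= -(deriveE v dua).
rewrite derive_mx; last exact: diff_derivable.
rewrite [X in 'd g _ X]row_sum_delta linear_sum; apply: eq_bigr => i _.
by rewrite linearZ /= mxE /partial (deriveE _ dg).
Qed.

End chain_rule.

Section smooth_on.
Context {R : realType} {n : nat}.
Implicit Types (U : set 'rV[R]_n) (f : 'rV[R]_n -> R).

Lemma smooth_on_continuous U f y : smooth_on U f -> U y -> {for y, continuous f}.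
Proof. by move=> sf Uy; have [] := sf [::] y Uy. Qed.

Lemma smooth_on_partial U f i : smooth_on U f -> smooth_on U (partial i f).
Proof.
move=> sf s y Uy; have := sf (rcons s i) y Uy.
by rewrite /partials foldr_rcons.
Qed.

Lemma smooth_on_differentiable U f y : open U -> smooth_on U f -> U y ->
  differentiable f y.
Proof.
move=> oU sf Uy; apply: C1_differentiable.
  near=> z; move=> i.
  have Uz : U z by near: z; apply: open_nbhs_nbhs.
  by have [_] := sf [::] z Uz; exact.
by move=> i; exact: smooth_on_continuous (smooth_on_partial i sf) Uy.
Unshelve. all: by end_near. Qed.

End smooth_on.

Section continuous_matrices.
Context {R : realType} {T : topologicalType} (y : T).

Lemma continuous_det n (A : T -> 'M[R]_n) :
  (forall i j, {for y, continuous (fun z => A z i j)}) ->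
  {for y, continuous (fun z => \det (A z))}.
Proof.
move=> cA; rewrite /continuous_at /determinant.
apply: (@cvg_sumr R T (nbhs y) _ _ _
  (fun (s : {perm 'I_n}) z => (-1) ^+ s * \prod_i A z i (s i))) => s.
apply: (@cvgM R T (nbhs y) _ (cst _)); first exact: cvg_cst.
by apply: (@cvg_prodr R T (nbhs y) _ _ _ (fun i z => A z i (s i))) => i; exact: cA.
Qed.

Lemma continuous_invmx n (A : T -> 'M[R]_n) :
  (forall i j, {for y, continuous (fun z => A z i j)}) ->
  (\forall z \near y, A z \in unitmx) ->
  forall i j, {for y, continuous (fun z => invmx (A z) i j)}.
Proof.
move=> cA uA i j.
have cdet := continuous_det cA.
have uAy : A y \in unitmx by exact: nbhs_singleton uA.
have e : invmx (A y) i j = (\det (A y))^-1 * cofactor (A y) j i.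
  by rewrite /invmx uAy !mxE.
suff : (fun z => invmx (A z) i j) @ y --> invmx (A y) i j by [].
rewrite e.
apply: (@cvg_trans _ ((fun z => (\det (A z))^-1 * cofactor (A z) j i) @ y)).
  by apply: near_eq_cvg; near=> z; rewrite /invmx ifT ?mxE//; near: z.
apply: cvgM.
  by apply: cvgV => //; rewrite -unitfE -unitmxE.
rewrite /cofactor; apply: (@cvgM R T (nbhs y) _ (cst _)); first exact: cvg_cst.
apply: continuous_det => k l.
rewrite (_ : (fun z => _) = fun z => A z (lift j k) (lift i l)); first exact: cA.
by apply/funext => z; rewrite !mxE.
Unshelve. all: by end_near. Qed.

End continuous_matrices.

(** The quadratic form vanishes on the kernel. *)
Lemma posdef_unitmx (R : realFieldType) n (A : 'M[R]_n) :
  (forall v : 'rV[R]_n, v != 0 -> 0 < (v *m A *m v^T) 0 0) -> A \in unitmx.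
Proof.
move=> pA; rewrite -row_free_unit -kermx_eq0; apply/negPn/negP => /rowV0Pn[v].
move=> /sub_kermxP vA /pA; by rewrite vA mul0mx mxE ltxx.
Qed.

Section rV_measurability.
Context {R : realType} {d : measure_display} {T : measurableType d} {n : nat}.
Variable c : T -> 'rV[R]_n.
Hypothesis mc : forall i, measurable_fun setT (fun t => c t 0 i).

(** An open set is a union of cubes with rational centres and radii [1/(m+1)], hence
a countable one, and the preimage of a cube is a finite intersection. *)
Lemma measurable_rV_open (O : set 'rV[R]_n) : open O -> measurable (c @^-1` O).
Proof.
move=> oO.
pose ctr (q : 'rV[rat]_n) : 'rV[R]_n := map_mx ratr q.
pose rad (m : nat) : R := m.+1%:R^-1.
have mball q m : measurable (c @^-1` [set y : 'rV[R]_n | forall i, `|ctr q 0 i -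
  y 0 i| < rad m]).
  rewrite (_ : _ @^-1` _ = \bigcap_(i in [set: 'I_n])
    ((fun t => c t 0 i) @^-1` ball (ctr q 0 i) (rad m))).
    apply: fin_bigcap_measurable => //.
    move=> i _; rewrite -[_ @^-1` _]setTI; apply: mc => //; exact: measurable_ball.
  by apply/seteqP; split=> t /= h i; [move=> _; exact: h|exact: h].
pose D := [set qm : 'rV[rat]_n * nat |
  [set y : 'rV[R]_n | forall i, `|ctr qm.1 0 i - y 0 i| < rad qm.2] `<=` O].
rewrite (_ : c @^-1` O = \bigcup_(qm in D)
    c @^-1` [set y : 'rV[R]_n | forall i, `|ctr qm.1 0 i - y 0 i| < rad qm.2]).
  rewrite bigcup_mkcond; apply: countable_bigcupT_measurable => // qm.
  by case: ifPn.
apply/seteqP; split=> [t Ot|t [qm /= h] /h //].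
have [e /= e0 He] : nbhs_ball (c t) O by apply/nbhs_ballP; exact: open_nbhs_nbhs.
have [m me] : exists m, rad m < e / 2.
  have /cvgrPdist_lt/(_ (e / 2))[|m _ /(_ m (leqnn _))] := @cvg_harmonic R.
    by rewrite divr_gt0.
  by rewrite sub0r normrN /= ger0_norm// => h; exists m.
have m0 : 0 < rad m by rewrite invr_gt0.
have /choice[q Hq] (i : 'I_n) : exists q : rat, `|ratr q - c t 0 i| < rad m.
  have /rat_in_itvoo[q] : c t 0 i - rad m < c t 0 i + rad m by lra.
  by rewrite in_itv /= => /andP[q1 q2]; exists q; rewrite ltr_distl q1 q2.
exists (\row_i q i, m); last by move=> i /=; rewrite !mxE.
move=> y /= Hy; apply: He; rewrite -ball_normE /=.
apply: (@le_lt_trans _ _ (rad m + rad m)).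
  apply: normr_rV_le; first by rewrite addr_ge0// ltW.
  move=> i; have := Hy i; rewrite !mxE => yi; have := Hq i.
  rewrite distrC => ci; apply: le_trans (ler_distD (ratr (q i)) _ _) _.
  by rewrite lerD// ltW.
lra.
Qed.

Lemma measurable_continuous_rV (k : 'rV[R]_n -> R) : continuous k ->
  measurable_fun setT (fun t => k (c t)).
Proof.
move=> ck; apply: (@measurability _ _ T R _ _ _ (RGenOInfty.measurableE R)).
move=> _ [_ [x ->] <-]; rewrite setTI.
apply: (@measurable_rV_open (k @^-1` `]x, +oo[%classic)).
apply: open_comp; last exact: interval_open.
by move=> y _; exact: ck.
Qed.

End rV_measurability.

(** * Charts and gradients *)

Section charts.
Context {R : realType} {X : topologicalType} {d : nat}.
Implicit Types c : chart R X d.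

Lemma nbhs_cdom c x : cdom c x -> nbhs x (cdom c).
Proof. by move=> cx; apply: open_nbhs_nbhs; split=> //; exact: cdom_open. Qed.

Lemma nbhs_crange c y : crange c y -> nbhs y (crange c).
Proof. by move=> cy; apply: open_nbhs_nbhs; split=> //; exact: crange_open. Qed.

(** The bump is a tent function [max 0 (r - |y - y0|)] in the chart, extended by
zero; in a Hausdorff space the compact image of its support is closed, so the
extension is continuous. *)
Lemma chart_bump c (O : set X) p : hausdorff_space X -> cdom c p -> nbhs p O ->
  exists f : Cc R X, [/\ forall x, 0 <= f x, 0 < f p & [set x | 0 < f x] `<=` O].
Proof.
move=> hX cp Op.
set y0 := cmap c p.
have cy0 : crange c y0 by exact: cmap_range.
have : nbhs y0 (crange c `&` cinv c @^-1` O).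
  apply: filterI; first exact: nbhs_crange.
  apply: (cinv_continuous cy0); rewrite /y0 cmapK//.
rewrite -nbhs_ballE => -[e /= e0 He].
pose r := e / 2.
have r0 : 0 < r by rewrite divr_gt0.
have re : r < e by rewrite /r ltr_pdivrMr// ltr_pMr// ltr1n.
pose B := [set y | `|y - y0| <= r].
have BO y : B y -> crange c y /\ O (cinv c y).
  move=> By; apply: He; rewrite -ball_normE /=.
  by rewrite distrC (le_lt_trans By).
(* In coordinates the tent vanishes off [B], which lies in the range of the chart. *)
pose f x := if x \in cdom c then Num.max 0 (r - `|cmap c x - y0|) else 0.
have cB : compact B.
  apply: bounded_closed_compact.
    exists (r + `|y0|); split; first exact: num_real.
    move=> M rM y By /=; rewrite -(subrK y0 y).
    by apply: (le_trans (ler_normD _ _)); apply: ltW; apply: le_lt_trans rM;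
      rewrite lerD.
  have -> : B = (fun y => `|y - y0|) @^-1` [set t | t <= r] by [].
  apply: preimage_closed; last exact: closed_le.
  have cn : continuous (fun y : 'rV[R]_d => `|y - y0|).
    move=> y; apply: (@cvg_norm R 'rV[R]_d _ (nbhs y) _ (fun y => y - y0) (y - y0)).
    by apply: (@cvgB R 'rV[R]_d _ (nbhs y) _ id (cst y0) y y0);
      [exact: cvg_id|exact: cvg_cst].
  by move=> y _; exact: cn.
pose K := cinv c @` B.
have cK : compact K.
  apply: continuous_compact => //; apply: continuous_in_subspaceT => y.
  by rewrite inE => /BO[? _]; exact: cinv_continuous.
have clK : closed K by exact: compact_closed.
have fK x : f x != 0 -> K x.
  rewrite /f; case: ifPn => [/set_mem cx|]; last by rewrite eqxx.
  move=> fx; exists (cmap c x); last by rewrite cmapK.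
  rewrite /B /= leNgt; apply: contraNN fx => h.
  by apply/eqP/max_idPl; rewrite subr_le0 ltW.
have f0 x : 0 <= f x by rewrite /f; case: ifP => // _; rewrite le_max lexx.
have cf : continuous f.
  move=> x; rewrite /continuous_at; have [cx|cx] := pselect (cdom c x).
    have -> : f x = Num.max 0 (r - `|cmap c x - y0|) by rewrite /f mem_set.
    apply: (@cvg_trans _ ((fun x => Num.max 0 (r - `|cmap c x - y0|)) @ x)).
      apply: near_eq_cvg; near=> z; rewrite /f mem_set//.
      by near: z; exact: nbhs_cdom.
    apply: (@continuous_max R X (cst 0) (fun x => r - `|cmap c x - y0|)).
      exact: cvg_cst.
    apply: (@cvgB R R _ (nbhs x) _ (cst r) (fun x => `|cmap c x - y0|) r);
      first exact: cvg_cst.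
    apply: (@cvg_norm R 'rV[R]_d _ (nbhs x) _ (fun x => cmap c x - y0)
      (cmap c x - y0)).
    apply: (@cvgB R 'rV[R]_d _ (nbhs x) _ (cmap c) (cst y0) (cmap c x) y0);
      last exact: cvg_cst.
    exact: cmap_continuous.
  have -> : f x = 0 by rewrite /f memNset.
  have nKx : (~` K) x by move=> [y /BO[? _] yx]; apply: cx; rewrite -yx;
    exact: cinv_dom.
  apply: (@cvg_trans _ ((cst 0 : X -> R) @ x)); last exact: cvg_cst.
  apply: near_eq_cvg; near=> z.
  have : (~` K) z.
    by near: z; apply: open_nbhs_nbhs; split => //; exact: closed_openC.
  by move=> nKz; apply/esym/eqP; apply: contrapT => /negP /fK.
have sf : compact_support f.
  apply: (subclosed_compact (@closed_closure _ _) cK).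
  by rewrite [X in _ `<=` X](closure_id K).1//; apply: closureS.
exists (CcFun cf sf); split => //=.
  by rewrite /f mem_set// subrr normr0 subr0 lt_max r0 orbT.
move=> x /lt0r_neq0 /fK [y /BO[_ Oy] <-] //.
Unshelve. all: by end_near.
Qed.

End charts.

Section riemannian_charts.
Context {R : realType} {X : ptopologicalType} {d : nat}.
Variable M : oriented_riemannian R X d.
Implicit Types (f g : X -> R) (i j : atlas M).

Definition differential_in i f y : 'rV[R]_d :=
  \row_k partial k (f \o cinv (M i)) y.

Lemma metric_unit i y : crange (M i) y -> metric i y \in unitmx.
Proof. by move=> iy; apply: posdef_unitmx; exact: metric_posdef. Qed.

Lemma chart_atP x : cdom (M (chart_at M x)) x.
Proof. exact: (projT2 (cid (atlas_cover M x))). Qed.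

Lemma smooth_continuous f : smooth M f -> continuous f.
Proof.
move=> sf x; have cx := chart_atP x; set i := chart_at M x in cx.
have := smooth_on_continuous (sf i) (cmap_range cx) => cf.
rewrite /continuous_at -{2}(cmapK cx).
apply: (@cvg_trans _ ((f \o cinv (M i)) \o cmap (M i) @ x)).
  apply: near_eq_cvg; near=> z; rewrite /= cmapK//.
  by near: z; exact: nbhs_cdom.
apply: continuous_comp; [exact: cmap_continuous|exact: cf].
Unshelve. all: by end_near. Qed.

Lemma nbhs_overlap i j x : cdom (M i) x -> cdom (M j) x ->
  nbhs (cmap (M i) x) (overlap (M i) (M j)).
Proof.
move=> ix jx; apply: filterI; first by apply: nbhs_crange; exact: cmap_range.
apply: (cinv_continuous (cmap_range ix)); rewrite cmapK//; exact: nbhs_cdom.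
Qed.

Lemma open_overlap i j : open (overlap (M i) (M j)).
Proof.
rewrite openE => y [iy jy]; rewrite /interior.
have := nbhs_overlap (cinv_dom iy) jy; by rewrite cinvK.
Qed.

(** The chain rule for the change of charts, in the row-vector convention. *)
Lemma differential_in_transition f i j x : smooth M f ->
  cdom (M i) x -> cdom (M j) x ->
  differential_in i f (cmap (M i) x) =
  differential_in j f (cmap (M j) x) *m
    ('J (transition (M i) (M j)) (cmap (M i) x))^T.
Proof.
move=> sf ix jx; set y := cmap (M i) x; set T := transition (M i) (M j).
have oy : overlap (M i) (M j) y by exact: nbhs_singleton (nbhs_overlap ix jx).
have Ty : T y = cmap (M j) x by rewrite /T /transition /= cmapK.
have dT k : differentiable (fun z => T z 0 k) y.
  exact: (smooth_on_differentiable (@open_overlap i j)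
    (@atlas_smooth _ _ _ M i j k) oy).
have df : differentiable (f \o cinv (M j)) (T y).
  rewrite Ty.
  exact: (smooth_on_differentiable (@crange_open _ _ _ (M j)) (sf j)
    (cmap_range jx)).
apply/rowP => k; rewrite [LHS]mxE [RHS]mxE.
have e : {near y, f \o cinv (M i) =1 (fun z => (f \o cinv (M j)) (T z))}.
  near=> z; have [iz jz] : overlap (M i) (M j) z by near: z; exact: nbhs_overlap.
  by rewrite /T /transition /= cmapK.
rewrite /partial (near_eq_derive _ e) derive_comp_rV//.
apply: eq_bigr => l _.
rewrite [X in _ = X * _]mxE [X in _ = _ * X]mxE /partial Ty mulrC; congr (_ * _).
have dTy := differentiable_rV dT.
have := derive_mx (@diff_derivable _ _ _ _ _ (delta_mx 0 k) dTy).
rewrite deriveEjacobian// -rowE => /rowP/(_ l).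
by rewrite [in LHS]mxE => ->; rewrite mxE.
Unshelve. all: by end_near. Qed.

Definition cotangent_inner i f g y : R :=
  (differential_in i f y *m invmx (metric i y) *m (differential_in i g y)^T) 0 0.

(** The inverse Gram matrices transform by the inverse Jacobians, which cancel those
of the differentials.  This makes the inner product of two gradients computable
in any chart, although [gradient] is defined by a chart chosen at each point. *)
Lemma cotangent_inner_transition f g i j x : smooth M f -> smooth M g ->
  cdom (M i) x -> cdom (M j) x ->
  cotangent_inner i f g (cmap (M i) x) = cotangent_inner j f g (cmap (M j) x).
Proof.
move=> sf sg ix jx; rewrite /cotangent_inner.
rewrite !(differential_in_transition _ ix jx)//.
set J := 'J _ _; set y := cmap (M i) x.
have oy : overlap (M i) (M j) y by exact: nbhs_singleton (nbhs_overlap ix jx).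
have uJ : J \in unitmx by rewrite unitmxE unitfE gt_eqF// atlas_oriented.
have ui : metric i y \in unitmx by apply: metric_unit; exact: cmap_range.
have uj : metric j (cmap (M j) x) \in unitmx by apply: metric_unit;
  exact: cmap_range.
have compat := metric_compat oy.
have Ty : transition (M i) (M j) y = cmap (M j) x by rewrite /transition /= cmapK.
rewrite /= Ty -/J in compat.
have K : J^T *m invmx (metric i y) *m J = invmx (metric j (cmap (M j) x)).
  set G := metric j _ in compat uj *.
  have e : J *m (G *m (J^T *m invmx (metric i y) *m J)) = J.
    by rewrite !mulmxA -compat mulmxV// mul1mx.
  by rewrite -[LHS](mulKmx uj) -[G *m _](mulKmx uJ) e mulVmx// mulmx1.
by rewrite -K trmx_mul trmxK !mulmxA.
Qed.

Lemma tangent_inner_gradient f g x :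
  tangent_inner M (gradient M f x) (gradient M g x) =
  cotangent_inner (chart_at M x) f g (cmap (M (chart_at M x)) x).
Proof.
rewrite /tangent_inner /gradient /cotangent_inner /metric_at.
have iy := cmap_range (chart_atP x).
have u := metric_unit iy; have s := Defs.metric_sym iy.
rewrite mulmxKV// trmx_mul trmx_inv s mulmxA//.
Qed.

(** Near a given point one may work in a single chart, where everything is a sum of
products of continuous coefficients. *)
Lemma continuous_gradient_inner f g : smooth M f -> smooth M g ->
  continuous (fun x => tangent_inner M (gradient M f x) (gradient M g x)).
Proof.
move=> sf sg x; have ix := chart_atP x; set i := chart_at M x in ix.
rewrite /continuous_at tangent_inner_gradient -/i.
apply: (@cvg_trans _ (cotangent_inner i f g \o cmap (M i) @ x)).
  apply: near_eq_cvg; near=> z; rewrite tangent_inner_gradient /=.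
  apply: cotangent_inner_transition => //; last exact: chart_atP.
  by near: z; exact: nbhs_cdom.
apply: continuous_comp; first exact: cmap_continuous.
set y := cmap (M i) x; have iy : crange (M i) y by exact: cmap_range.
have cdiff h k : smooth M h -> {for y, continuous
  (fun z => differential_in i h z 0 k)}.
  move=> sh; rewrite (_ : (fun z => _) = partial k (h \o cinv (M i))).
    exact: smooth_on_continuous (smooth_on_partial k (sh i)) iy.
  by apply/funext => z; rewrite mxE.
have cinvm k l : {for y, continuous (fun z => invmx (metric i z) k l)}.
  apply: continuous_invmx.
    by move=> k' l'; exact: smooth_on_continuous (@metric_smooth _ _ _ M i k' l')
      iy.
  by near=> z; apply: metric_unit; near: z; exact: nbhs_crange.
rewrite /cotangent_inner.
rewrite (_ : (fun z => _) = fun z => \sum_l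
  (\sum_k differential_in i f z 0 k * invmx (metric i z) k l) * differential_in i
  g z 0 l); last first.
  apply/funext => z; rewrite mxE; apply: eq_bigr => l _; rewrite [in RHS]mxE;
    congr (_ * _); by rewrite !mxE.
rewrite /continuous_at.
apply: (@cvg_sumr R _ (nbhs y) _ _ _ (fun l z =>
  (\sum_k differential_in i f z 0 k * invmx (metric i z) k l) * differential_in i
  g z 0 l)) => l.
apply: (@cvgM R _ (nbhs y)); last exact: (cdiff g l sg).
apply: (@cvg_sumr R _ (nbhs y) _ _ _ (fun k z => differential_in i f z 0 k *
  invmx (metric i z) k l)) => k.
by apply: (@cvgM R _ (nbhs y)); [exact: (cdiff f k sf)|exact: cinvm].
Unshelve. all: by end_near. Qed.

Lemma gradient_support f x : ~ closure [set z | f z != 0] x -> gradient M f x = 0.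
Proof.
move=> fx; rewrite /gradient (_ : \row_j _ = 0) ?mul0mx//.
have ix := chart_atP x; set i := chart_at M x in ix *.
apply/rowP => k; rewrite !mxE /partial.
have e : {near cmap (M i) x, f \o cinv (M i) =1 cst 0}.
  have h : nbhs (cinv (M i) (cmap (M i) x)) (~` closure [set z | f z != 0]).
    rewrite cmapK//; apply: open_nbhs_nbhs; split=> //.
    by apply: closed_openC; exact: closed_closure.
  near=> z; have nz : (~` closure [set z | f z != 0]) (cinv (M i) z).
    near: z; exact: (cinv_continuous (cmap_range ix) h).
  by apply/eqP; apply: contrapT => /negP fz; apply: nz; exact: subset_closure.
by rewrite (near_eq_derive _ e) derive_cst.
Unshelve. all: by end_near. Qed.

End riemannian_charts.

(** * Cozero sets of compactly supported functions *)

Section separating.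
Context {R : realType} {X : ptopologicalType}.

Definition separating := forall (O : set X) p, nbhs p O ->
  exists f : Cc R X, [/\ forall x, 0 <= f x, 0 < f p & [set x | 0 < f x] `<=` O].

(** Such sets are open and relatively compact, and the vague topology sees them
directly: γ avoids [{f > 0}] iff the pairing of γ with [f] vanishes. *)
Definition cozero : set (set X) :=
  [set U | exists2 f : Cc R X, forall x, 0 <= f x & U = [set x | 0 < f x]].

Lemma Cc_binop (h : R -> R -> R) (f g : Cc R X) : h 0 0 = 0 ->
  (forall u v : X -> R, continuous u -> continuous v ->
    continuous (fun x => h (u x) (v x))) ->
  exists k : Cc R X, forall x, k x = h (f x) (g x).
Proof.
move=> h0 hc.
have ck := hc _ _ (@Cc_continuous _ _ f) (@Cc_continuous _ _ g).
have sk : compact_support (fun x => h (f x) (g x)).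
  apply: (subclosed_compact (@closed_closure _ _)).
    exact: (compactU (@Cc_compact_support _ _ f) (@Cc_compact_support _ _ g)).
  rewrite -closureU; apply: closureS => x /= hx.
  have [fx|fx] := eqVneq (f x) 0; last by left.
  by right; apply: contraNN hx => /eqP ->; rewrite fx h0.
by exists (CcFun ck sk).
Qed.

Lemma Cc_oppr (f : Cc R X) : exists k : Cc R X, forall x, k x = - f x.
Proof.
apply: (@Cc_binop (fun a _ => - a) f f); first exact: oppr0.
by move=> u v cu _ x; apply: (@cvgN _ _ _ (nbhs x)); exact: cu.
Qed.

Lemma cozero0 : cozero set0.
Proof.
have s0 : compact_support (cst 0 : X -> R).
  rewrite /compact_support (_ : [set x | _] = set0) ?closure0; last first.
    by apply/seteqP; split => x //=; rewrite eqxx.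
  exact: compact0.
exists (CcFun (@cst_continuous X R 0) s0) => //=.
by apply/seteqP; split => x //=; rewrite ltxx.
Qed.

Lemma cozeroU U V : cozero U -> cozero V -> cozero (U `|` V).
Proof.
move=> [f f0 ->] [g g0 ->].
have [|u v cu cv|k kE] := @Cc_binop (fun a b => a + b) f g; first exact: addr0.
  by move=> x; apply: (@cvgD _ _ _ (nbhs x)); [exact: cu|exact: cv].
exists k => [x|]; first by rewrite kE addr_ge0.
apply/seteqP; split => x /=; rewrite kE.
  by case=> h; [exact: ltr_wpDr|exact: ltr_wpDl].
have [fx|fx] := ltP 0 (f x); first by left.
move=> h; right; apply: lt_le_trans h _.
by rewrite gerDr.
Qed.

Lemma cozeroI U V : cozero U -> cozero V -> cozero (U `&` V).
Proof.
move=> [f f0 ->] [g g0 ->].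
have [|u v cu cv|k kE] := @Cc_binop (fun a b => a * b) f g; first exact: mulr0.
  by move=> x; apply: (@cvgM _ _ (nbhs x)); [exact: cu|exact: cv].
exists k => [x|]; first by rewrite kE mulr_ge0.
apply/seteqP; split => x /=; rewrite kE; first by move=> [? ?]; exact: mulr_gt0.
move=> h; rewrite !lt0r f0 g0 !andbT; split; apply: contraTN h => /eqP ->;
  by rewrite ?mul0r ?mulr0 ltxx.
Qed.

Lemma cozero_open U : cozero U -> open U.
Proof.
move=> [f _ ->]; apply: (@open_comp _ _ f [set t | 0 < t]); last exact: open_gt.
by move=> x _; exact: Cc_continuous.
Qed.

Lemma cozero_relatively_compact U : cozero U -> relatively_compact U.
Proof.
move=> [f _ ->]; apply: (subclosed_compact (@closed_closure _ _)
  (@Cc_compact_support _ _ f)).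
by apply: closureS => x /= /lt0r_neq0.
Qed.

Lemma cozero_bigsetU (I : Type) (s : seq I) (V : I -> set X) :
  (forall i, cozero (V i)) -> cozero (\big[setU/set0]_(i <- s) V i).
Proof.
move=> cV; elim: s => [|i s IH]; first by rewrite big_nil; exact: cozero0.
by rewrite big_cons; exact: cozeroU.
Qed.

Definition cozero_base (V : nat -> set X) :=
  (forall n, cozero (V n)) /\
  forall O p, nbhs p O -> exists n, V n p /\ V n `<=` O.

(** Between two nested members [B1] and [B2] of a countable base at most one cozero
set is chosen; these countably many choices suffice, since any cozero set that
is a neighbourhood of [p] inside [B2] contains some [B1] around [p]. *)
Lemma cozero_baseP : separating -> @second_countable X -> exists V, cozero_base V.
Proof.
move=> sX [B /countable_injP[c ci] [Bo Bb]].
pose P (k : nat) (U : set X) := cozero U /\ exists B1 B2, [/\ B B1, B B2,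
  unpickle k = Some (c B1, c B2), B1 `<=` U & U `<=` B2].
exists (fun k => xget set0 (P k)); split=> [k|O p Op].
  by case: xgetP => [U _ []|_] //; exact: cozero0.
have [B2 [BB2 B2p] B2O] := Bb p O Op.
have B2n : nbhs p B2 by apply: open_nbhs_nbhs; split => //; exact: Bo.
have [f [f0 fp fB2]] := sX _ _ B2n.
pose U := [set x | 0 < f x].
have cU : cozero U by exists f.
have Un : nbhs p U by apply: open_nbhs_nbhs; split => //; exact: cozero_open.
have [B1 [BB1 B1p] B1U] := Bb p U Un.
exists (pickle (c B1, c B2)).
have PU : exists U, P (pickle (c B1, c B2)) U.
  by exists U; split => //; exists B1, B2; split => //; rewrite pickleK.
have [_ [B1' [B2' [BB1' BB2']]]] := xgetPex set0 PU.
rewrite pickleK => -[/esym e1 /esym e2].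
rewrite (ci _ _ _ _ e1) ?inE// (ci _ _ _ _ e2) ?inE// => h1 h2; split;
  first exact: h1.
exact: subset_trans h2 B2O.
Qed.

Section base.
Variables (V : nat -> set X) (bV : cozero_base V).

Lemma cozero_base_cover x : exists n, V n x.
Proof. by have [n []] := bV.2 setT x filterT; exists n. Qed.

Lemma open_cozero_base O : open O -> O = \bigcup_(n in [set n | V n `<=` O]) V n.
Proof.
move=> oO; apply/seteqP; split=> [p Op|p [n /= h /h]//].
by have [n [? ?]] := bV.2 O p (open_nbhs_nbhs (conj oO Op)); exists n.
Qed.

Lemma compact_sub_cozero K : compact K -> exists2 U, cozero U & K `<=` U.
Proof.
rewrite compact_cover => /(_ nat setT V)[|x _|D _ KD].
- by move=> n _; exact/cozero_open/bV.1.
- by have [n Vn] := cozero_base_cover x; exists n.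
exists (\big[setU/set0]_(i <- finmap.enum_fset D) V i);
  first exact/cozero_bigsetU/bV.1.
move=> x /KD [i iD Vix]; rewrite -bigcup_seq; exists i => //.
Qed.

Lemma borel_cozeroE : @measurable _ (borel X) = <<s cozero >>.
Proof.
apply/seteqP; split.
  apply: smallest_sub; first exact: smallest_sigma_algebra.
  move=> O /open_cozero_base ->.
  have -> : \bigcup_(n in [set n | V n `<=` O]) V n =
      \bigcup_n (if `[< V n `<=` O >] then V n else set0).
    apply/seteqP; split => x [n /= h Vn]; exists n => //; first by rewrite asboolT.
      by move: Vn; case: ifPn => // /asboolP.
    by move: Vn; case: ifPn.
  apply: sigma_algebra_bigcup => n; case: ifPn => _; last exact: sigma_algebra0.
  by apply: sub_sigma_algebra; exact: bV.1.
by apply: sub_sigma_algebra2 => U; exact: cozero_open.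
Qed.

End base.

End separating.
Arguments separating R X : clear implicits.
Arguments cozero R X : clear implicits.

(** * Void events and the enumeration of a configuration *)

Lemma eq_configuration (R : realType) (X : ptopologicalType)
  (g h : configuration R X) : points g = points h -> g = h.
Proof.
case: g h => A lA [B lB] /= AB; case: _ / AB lB => lB.
by congr Configuration; exact: Prop_irrelevance.
Qed.

(** Void events generate a σ-algebra that is small enough for its measures to be
determined by void probabilities and large enough for sums over γ
and for energies to be measurable. *)
Definition void_system (R : realType) (X : ptopologicalType) :
    set (set (configuration R X)) :=
  [set [set g : configuration R X | points g `&` U = set0] | U in cozero R X].

Notation Void R X := (g_sigma_algebraType (@void_system R X)).

Section enumeration.
Context {R : realType} {X : ptopologicalType}.
Hypotheses (hX : hausdorff_space X).
Variables (V : nat -> set X) (bV : cozero_base (R:=R) V).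
Implicit Types g : configuration R X.

Lemma void_system_setI : setI_closed (@void_system R X).
Proof.
move=> _ _ [A cA <-] [B cB <-]; exists (A `|` B); first exact: cozeroU.
by apply/seteqP; split => g /=; rewrite setIUr setU_eq0.
Qed.

(** The other points of γ in the closure of a bounded neighbourhood of [p] are
finitely many, hence form a closed set that can be avoided. *)
Lemma configuration_isolated g p O : points g p -> nbhs p O ->
  exists n, V n `<=` O /\ points g `&` V n = [set p].
Proof.
move=> gp Op.
have [n0 [Vn0 _]] := bV.2 setT p filterT.
pose S := points g `&` closure (V n0) `\ p.
have fS : finite_set S.
  apply: sub_finite_set (points_lf g (cozero_relatively_compact (bV.1 n0))).
  by move=> x [].
have clS : closed S.
  by apply: (accessible_finite_set_closed.1 (hausdorff_accessible hX)).
have : nbhs p (O `&` (V n0 `&` ~` S)).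
  apply: filterI => //; apply: filterI.
    by apply: open_nbhs_nbhs; split=> //; exact/cozero_open/bV.1.
  by apply: open_nbhs_nbhs; split; [exact: closed_openC|move=> [_ /(_ erefl)]].
move=> /(bV.2 _ p)[n [Vnp VnO]]; exists n; split; first by move=> x /VnO[].
apply/seteqP; split=> [x [gx Vx]|x ->//]; apply: contrapT => xp.
by have [_ [Vn0x]] := VnO _ Vx; apply; split=> //; split=> //;
  exact: subset_closure.
Qed.

Lemma closed_configuration g : closed (points g).
Proof.
move=> x gx; apply: contrapT => ngx; have [n Vx] := cozero_base_cover bV x.
have oV : open (V n) by exact/cozero_open/bV.1.
have clS : closed (points g `&` closure (V n)).
  apply: (accessible_finite_set_closed.1 (hausdorff_accessible hX)).
  by apply: points_lf; exact/cozero_relatively_compact/bV.1.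
have : nbhs x (V n `&` ~` (points g `&` closure (V n))).
  apply: filterI; first exact: open_nbhs_nbhs.
  by apply: open_nbhs_nbhs; split; [exact: closed_openC|move=> []].
move=> /gx [z [gz [Vz nz]]]; apply: nz; split => //; exact: subset_closure.
Qed.

Definition hits (B : set X) : set (configuration R X) :=
  [set g | points g `&` B !=set0].

Lemma measurable_hits O : open O -> measurable (hits O : set (Void R X)).
Proof.
move=> /(open_cozero_base bV) OV.
rewrite (_ : hits O = \bigcup_(n in [set n | V n `<=` O]) hits (V n)).
  apply: bigcup_measurable => n _.
  rewrite (_ : hits (V n) = ~` [set g | points g `&` V n = set0]).
    apply: measurableC; apply: sub_sigma_algebra; exists (V n) => //; exact: bV.1.
  apply/seteqP; split=> g /=; first by move=> [x h] h0; rewrite h0 in h.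
  by move=> /eqP/set0P.
apply/seteqP; split=> [g [x [gx]]|g [n /= VO [x [gx Vx]]]].
  by rewrite {1}OV => -[n /= VO Vx]; exists n => //; exists x.
by exists x; split=> //; exact: VO.
Qed.

Definition singly n : set (configuration R X) :=
  [set g | exists p, points g `&` V n = [set p]].

(** Among the members of the base that isolate a given point of γ only the one of
least index is retained, so that each point is enumerated once. *)
Definition isolates n : set (configuration R X) :=
  singly n `&` \bigcap_(m in [set m | (m < n)%N]) ~`
    (singly m `&` hits (V m `&` V n)).

(** γ has two points in [V n] iff it hits two disjoint basic subsets of [V n], which
is a countable condition. *)
Lemma measurable_singly n : measurable (singly n : set (Void R X)).
Proof.
pose D := [set ij : nat * nat | [/\ V ij.1 `<=` V n, V ij.2 `<=` V n & V ij.1 `&`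
  V ij.2 = set0]].
rewrite (_ : singly n = hits (V n) `\` \bigcup_(ij in D)
  (hits (V ij.1) `&` hits (V ij.2))).
  have oV k : open (V k) by exact/cozero_open/bV.1.
  apply: measurableD; first exact: measurable_hits.
  rewrite bigcup_mkcond; apply: countable_bigcupT_measurable => //.
  move=> ij; case: ifPn => // _.
  by apply: measurableI; exact: measurable_hits.
apply/seteqP; split=> g.
  move=> [p gp]; split; first by exists p; rewrite gp.
  move=> [[i j] /= [iV jV ij0] [[x [gx ix]] [y [gy jy]]]].
  have : (points g `&` V n) x by split=> //; exact: iV.
  have : (points g `&` V n) y by split=> //; exact: jV.
  rewrite gp /= => yp xp; subst x y.
  have : (V i `&` V j) p by [].
  by rewrite ij0.
move=> [[p [gp Vp]] nD]; exists p; apply/seteqP; split=> [q [gq Vq]|q ->//].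
apply: contrapT => qp; apply: nD.
move: hX; rewrite open_hausdorff => /(_ p q).
have pq : p != q by apply/eqP => pq; exact/qp.
move=> /(_ pq) [[A B] /= [/set_mem Ap /set_mem Bq] [oA oB AB0]].
have oV : open (V n) by exact/cozero_open/bV.1.
have [i [ip iA]] := bV.2 (V n `&` A) p (open_nbhs_nbhs
  (conj (openI oV oA) (conj Vp Ap))).
have [j [jq jB]] := bV.2 (V n `&` B) q (open_nbhs_nbhs
  (conj (openI oV oB) (conj Vq Bq))).
exists (i, j) => /=; last by split; [exists p|exists q].
split; [by move=> x /iA[]|by move=> x /jB[]|].
apply/seteqP; split=> // x [/iA[_ Ax] /jB[_ Bx]].
by move/eqP: AB0 => <-.
Qed.

Lemma measurable_isolates n : measurable (isolates n : set (Void R X)).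
Proof.
apply: measurableI; first exact: measurable_singly.
case: n => [|n].
  by rewrite (_ : [set m | _] = set0) ?bigcap_set0//; apply/seteqP; split.
apply: bigcap_measurable; first by exists 0%N.
move=> m _; apply: measurableC; apply: measurableI; first exact: measurable_singly.
by apply: measurable_hits; apply: openI; exact/cozero_open/bV.1.
Qed.

Definition isolated_point n g : X :=
  xget point [set x | isolates n g /\ (points g `&` V n) x].

Lemma isolated_pointP n g : isolates n g ->
  points g `&` V n = [set isolated_point n g].
Proof.
move=> ig; have [[p gp] _] := ig; rewrite /isolated_point.
case: xgetP => [x _ [_]|/(_ p)].
  by rewrite gp /= => ->.
by case; split=> //; rewrite gp.
Qed.

(** The isolated point lies in [U] iff γ hits [V n `&` U]. *)
Lemma measurable_isolated_point n :
  measurable_fun setT (isolated_point n : Void R X -> borel X).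
Proof.
apply: (@measurability _ _ _ (borel X) _ _ (@open X)); first by [].
move=> _ [U oU <-]; rewrite setTI.
rewrite (_ : _ @^-1` U = (isolates n `&` hits (V n `&` U)) `|`
   (* Where [V n] isolates nothing, [isolated_point n] is the default point. *)
   (if `[< U point >] then ~` isolates n else set0)).
  apply: measurableU.
    apply: measurableI; first exact: measurable_isolates.
    by apply: measurable_hits; apply: openI => //; exact/cozero_open/bV.1.
  by case: ifPn => // _; apply: measurableC; exact: measurable_isolates.
apply/seteqP; split=> g /=.
  have [ig|ig] := pselect (isolates n g).
    move=> Ug; left; split=> //; exists (isolated_point n g).
    have : (points g `&` V n) (isolated_point n g) by rewrite isolated_pointP.
    by move=> [? ?].
  rewrite {1}/isolated_point; case: xgetP => [x _ []//|_ Up].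
  by right; rewrite asboolT.
case.
  move=> [ig [x [gx [Vx Ux]]]].
  have : (points g `&` V n) x by [].
  by rewrite isolated_pointP//= => <-.
case: ifPn => // /asboolP Up ig.
by rewrite /isolated_point; case: xgetP => [x _ []//|_].
Qed.

Lemma isolated_point_bij g :
  set_bij [set n | isolates n g] (points g) (isolated_point^~ g).
Proof.
split.
- move=> n /= /isolated_pointP gn.
  by have [] : (points g `&` V n) (isolated_point n g) by rewrite gn.
- have main m n : isolates m g -> isolates n g -> (m < n)%N ->
    isolated_point m g = isolated_point n g -> False.
    move=> im i_n mn e; have [sn /(_ m) ln] := i_n; apply: (ln mn); split;
      first by case: im.
    have [gm Vm] : (points g `&` V m) (isolated_point m g) by rewrite
      isolated_pointP.
    have [_ Vn] : (points g `&` V n) (isolated_point n g).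
      by rewrite isolated_pointP.
    by exists (isolated_point m g); split=> //; split=> //; rewrite e.
  move=> m n; rewrite !inE /= => im i_n e.
  have [mn|nm|//] := ltngtP m n; first by case: (main m n).
  by case: (main n m).
- move=> p gp.
  have ex : exists n, `[< points g `&` V n = [set p] >].
    have [n [_ gn]] := configuration_isolated gp filterT.
    by exists n; exact/asboolP.
  have ig : isolates (ex_minn ex) g.
    case: ex_minnP => n /asboolP gn nmin; split; first by exists p.
    move=> m /= mn [[q gq] [x [gx [Vmx Vnx]]]].
    have : (points g `&` V n) x by [].
    rewrite gn /= => xp; subst x.
    have qp : p = q by have : (points g `&` V m) p by []; rewrite gq.
    by have := nmin m; rewrite asboolT ?qp// leqNgt mn => /(_ isT).
  exists (ex_minn ex) => //.
  move: (isolated_pointP ig); case: ex_minnP => n /asboolP -> _ h.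
  by have : [set p] (isolated_point n g) by rewrite h.
Qed.

Lemma isolation_weight_ge0 n g : 0 <= \1_(isolates n) g :> R.
Proof. by []. Qed.
Definition isolation_weight n g := NngNum (isolation_weight_ge0 n g).

Local Open Scope ereal_scope.

Lemma esum_isolated_point g (f : X -> \bar R) : (forall x, 0 <= f x) ->
  \esum_(x in points g) f x =
  \sum_(n <oo) (\1_(isolates n) g)%:E * f (isolated_point n g).
Proof.
move=> f0.
rewrite (@reindex_esum _ _ _ _ _ _ f (isolated_point_bij g)).
rewrite nneseries_esumT; last by move=> n; rewrite mule_ge0// lee_fin.
rewrite esum_mkcond; apply: eq_esum => n _.
rewrite indicE; have [ig|ig] := pselect (isolates n g).
  by rewrite !mem_set// mul1e.
by rewrite !memNset// mul0e.
Qed.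

Lemma config_measureE g (B : set (borel X)) :
  config_measure g B = \esum_(x in points g) (\1_B x)%:E.
Proof.
rewrite /config_measure/= /counting_on.
transitivity (\esum_(x in points g `&` B) (1 : \bar R)).
  rewrite /counting; case: asboolP => h; first by rewrite
    (@finite_card_sum _ (borel X)).
  rewrite -(@infinite_card_dirac _ (borel X) R _ h).
  by apply: eq_esum => x hx; rewrite diracE mem_set.
rewrite esum_mkcondr; apply: eq_esum => x _.
by rewrite indicE; case: (x \in B).
Qed.

(** This presents the counting measure of γ as a series of weighted Dirac measures
that depend measurably on γ. *)
Lemma config_measure_series g : config_measure g =
  mseries (fun n => mscale (isolation_weight n g)
    (\d_(isolated_point n g : borel X))) 0%N :> (set (borel X) -> \bar R).
Proof.
apply/funext => B; rewrite config_measureE esum_isolated_point//.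
Qed.

Lemma integral_config_measure g (f : borel X -> \bar R) :
  measurable_fun setT f -> (forall x, 0 <= f x) ->
  \int[config_measure g]_x f x = \esum_(x in points g) f x.
Proof.
move=> mf f0.
rewrite (eq_measure_integral (mseries (fun n => mscale (isolation_weight n g)
  (\d_(isolated_point n g : borel X))) 0%N)); last first.
  by move=> A mA _; rewrite config_measure_series.
rewrite ge0_integral_measure_series// esum_isolated_point//.
apply: eq_eseriesr => n _.
rewrite ge0_integral_mscale//= integral_dirac// diracT mul1e//.
Qed.

Lemma measurable_integral_config d' (T : measurableType d')
    (u : T -> Void R X) (h : T * borel X -> \bar R) :
  measurable_fun setT u -> measurable_fun setT h -> (forall z, 0 <= h z) ->
  measurable_fun setT (fun t => \int[config_measure (u t)]_x h (t, x)).
Proof.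
move=> mu mh h0.
under eq_fun => t.
  rewrite integral_config_measure//; last exact: measurableT_comp.
  rewrite esum_isolated_point//.
  over.
apply: ge0_emeasurable_sum => [n t _ _|n _]; first by rewrite mule_ge0// lee_fin.
apply: emeasurable_funM.
  apply/measurable_EFinP; apply: measurableT_comp mu => //.
  by apply: measurable_indic; exact: measurable_isolates.
apply: (measurableT_comp mh); apply: measurable_fun_pair => //.
by apply: measurableT_comp mu; exact: measurable_isolated_point.
Qed.

Lemma measurable_config_measure (B : set (borel X)) : measurable B ->
  measurable_fun setT (fun g : Void R X => config_measure g B).
Proof.
move=> mB.
rewrite (_ : (fun g => _) = fun g : Void R X => \int[config_measure g]_x
  (\1_B x)%:E).
  apply: (@measurable_integral_config _ (Void R X) id (fun z => (\1_B z.2)%:E))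
    => //.
  apply/measurable_EFinP; apply: measurableT_comp => //.
by apply/funext => g; rewrite integral_indic// setIT.
Qed.

End enumeration.

(** * Finite subconfigurations and the conditional energy *)

Lemma measurable_expeR (R : realType) : measurable_fun setT (@expeR R).
Proof.
rewrite (_ : @expeR R = fun x => maxe 0%E (er_map (@expR R) x)).
  by apply: measurable_maxe => //; apply: (@measurable_er_map _ (\bar R));
    exact: measurable_expR.
apply/funext => -[r| |] /=; last by rewrite max_l.
  by rewrite max_r// lee_fin expR_ge0.
by rewrite max_r.
Qed.

Section finite_subconfigurations.
Local Open Scope ereal_scope.
Context {R : realType} {X : ptopologicalType}.
Hypotheses (hX : hausdorff_space X).
Variables (V : nat -> set X) (bV : cozero_base (R:=R) V).
Implicit Types g : configuration R X.

Lemma config_measure_eq0 g (B : set (borel X)) :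
  (config_measure g B == 0) = `[< points g `&` B = set0 >].
Proof.
apply/eqP/asboolP => [|gB].
  rewrite (config_measureE g B); apply: contraPP => /eqP/set0P[x [gx Bx]] h.
  have : \esum_(x in points g) (\1_B x)%:E >= (1 : \bar R).
    apply: esum_ge; exists [set x]; first by split=> // y ->.
    by rewrite fsbig_set1 indicE mem_set.
  by rewrite h leNgt lte01.
rewrite config_measureE esum1// => x gx; rewrite indicE memNset// => Bx.
by have : (points g `&` B) x by []; rewrite gB.
Qed.

(** The events in terms of which hitting subconfigurations and energies are defined
are thereby turned into void events. *)
Lemma config_measure_gt0 g (B : set (borel X)) :
  (0 < config_measure g B) = `[< hits B g >].
Proof.
rewrite lt0e measure_ge0 andbT config_measure_eq0.
apply/negP/asboolP => h.
  by apply/set0P/eqP => gB; apply: h; exact/asboolP.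
by move=> /asboolP gB; move: h; rewrite /hits /= gB => -[].
Qed.

Lemma measurable_hits_borel (B : set (borel X)) : measurable B ->
  measurable (hits B : set (Void R X)).
Proof.
move=> mB; rewrite (_ : hits B = setT `&` [set g : Void R X | 0 < config_measure
  g B]).
  apply: emeasurable_fun_o_infty => //; exact: (measurable_config_measure hX bV).
by rewrite setTI; apply/seteqP; split=> g /=;
  rewrite config_measure_gt0 => /asboolP.
Qed.

(** The index encodes a finite list of indices of the base: the finite unions are
countably many. *)
Definition finite_cover n : set X :=
  \big[setU/set0]_(i <- odflt [::] (unpickle n : option (seq nat))) V i.

Lemma cozero_finite_cover n : cozero R X (finite_cover n).
Proof. by apply: cozero_bigsetU => i; exact: bV.1. Qed.

Lemma open_finite_cover n : open (finite_cover n).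
Proof. exact: cozero_open (cozero_finite_cover n). Qed.

Lemma measurable_finite_cover n : measurable (finite_cover n : set (borel X)).
Proof. by apply: sub_sigma_algebra; exact: open_finite_cover. Qed.

Lemma Bc_finite_cover n : Bc (finite_cover n).
Proof.
split; first exact: measurable_finite_cover.
exact: cozero_relatively_compact (cozero_finite_cover n).
Qed.

Lemma finite_crestrict g n : finite_set (crestrict g (finite_cover n)).
Proof.
apply: sub_finite_set (points_lf g (Bc_finite_cover n).2) => x [gx Ux].
by split => //; exact: subset_closure.
Qed.

(** Different finite covers may have the same trace on γ; retaining the least index
makes each finite subconfiguration counted once. *)
Definition carves n : set (configuration R X) :=
  [set g | forall m, (m < n)%N ->
    points g `&` finite_cover m <> points g `&` finite_cover n].

Lemma measurable_carves n : measurable (carves n : set (Void R X)).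
Proof.
rewrite (_ : carves n = ~` \bigcup_(m in [set m | (m < n)%N])
    ~` hits (finite_cover m `+` finite_cover n)).
  apply: measurableC; apply: bigcup_measurable => m _; apply: measurableC.
  apply: measurable_hits_borel.
  by apply: measurableU; apply: measurableD; exact: measurable_finite_cover.
apply/seteqP; split=> g /= h.
  move=> [m mn nh]; apply: (h m mn); apply/seteqP; split=> x [gx Ux]; split=> //;
  apply: contrapT => nU; apply: nh; exists x; split=> //; by [left|right].
move=> m mn e; apply: h; exists m => // -[x [gx [[Um Un]|[Un Um]]]].
  by have [] : (points g `&` finite_cover n) x by rewrite -e.
by have [] : (points g `&` finite_cover m) x by rewrite e.
Qed.

(** The points of a finite subconfiguration are isolated in γ by members of the
base; the union of these carves the subconfiguration out of γ. *)
Lemma carve_bij g Lam :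
  set_bij [set n | carves n g /\ hits Lam (crestrict g (finite_cover n))]
    (hitting_subconfigs Lam g `&` [set h | finite_set (points h)])
    (fun n => crestrict g (finite_cover n)).
Proof.
split.
- move=> n [_ hn]; split; last exact: finite_crestrict.
  split; first by move=> x [].
  by rewrite /N_in config_measure_gt0; exact/asboolP.
- have main m n : carves n g -> (m < n)%N ->
      crestrict g (finite_cover m) = crestrict g (finite_cover n) -> False.
    by move=> cn mn e; apply: (cn m mn); exact: (congr1 (@points _ _) e).
  move=> m n; rewrite !inE /= => -[cm _] [cn _] e.
  have [mn|nm|//] := ltngtP m n; first by case: (main m n).
  by case: (main n m).
- move=> h [[hg hL] /= hfin].
  have /choice[c cP] p : exists n, points h p -> points g `&` V n = [set p].
    have [hp|hp] := pselect (points h p); last by exists 0%N.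
    by have [n [_ gn]] := configuration_isolated hX bV (hg _ hp) filterT; exists n.
  have ex : exists n, `[< points g `&` finite_cover n = points h >].
    have /finite_seqP[s hs] := hfin.
    exists (pickle (map c s)); apply/asboolP.
    rewrite /finite_cover pickleK/= big_map -bigcup_seq.
    apply/seteqP; split=> [x [gx [p /= ps Vx]]|x hx].
      have hp : points h p by rewrite hs.
      have : (points g `&` V (c p)) x by [].
      by rewrite cP//= => ->.
    have : (points g `&` V (c x)) x by rewrite cP.
    by move=> [gx Vx]; split => //; exists x => //=; rewrite hs in hx.
  exists (ex_minn ex); case: ex_minnP => n /asboolP hn nmin; last first.
    exact: eq_configuration.
  split; last first.
    have -> : crestrict g (finite_cover n) = h by exact: eq_configuration.
    by apply/asboolP; rewrite -config_measure_gt0.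
  move=> m mn e; have := nmin m.
  by rewrite asboolT ?e// leqNgt mn => /(_ isT).
Qed.

(** A sum over an uncountable set of configurations that depends on γ becomes a
series of functions of γ. *)
Lemma esum_hitting_subconfigs g Lam (psi : configuration R X -> \bar R) :
  (forall h, 0 <= psi h) -> (forall h, infinite_set (points h) -> psi h = 0) ->
  \esum_(h in hitting_subconfigs Lam g) psi h =
  \sum_(n <oo) (\1_(carves n) g)%:E *
    ((\1_(hits Lam) (crestrict g (finite_cover n)))%:E *
     psi (crestrict g (finite_cover n))).
Proof.
move=> psi0 psiinf.
transitivity (\esum_(h in hitting_subconfigs Lam g `&`
  [set h | finite_set (points h)]) psi h).
  rewrite [RHS]esum_mkcondr; apply: eq_esum => h _.
  by case: ifPn => // /negP; rewrite inE => /psiinf.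
rewrite (@reindex_esum _ _ _ _ _ _ psi (carve_bij g Lam)).
rewrite nneseries_esumT; last by move=> n; rewrite !mule_ge0// lee_fin.
rewrite esum_mkcond; apply: eq_esum => n _.
rewrite !indicE; have [cn|cn] := pselect (carves n g); last first.
  by rewrite (memNset cn) mul0e memNset// => -[].
rewrite (mem_set cn) mul1e.
have [hn|hn] := pselect (hits Lam (crestrict g (finite_cover n))); last first.
  by rewrite (memNset hn) mul0e memNset// => -[].
by rewrite (mem_set hn) mul1e mem_set.
Qed.

Lemma B_Gamma_Void (A : set (borel X)) (E : set (configuration R X)) :
  B_Gamma A E -> measurable (E : set (Void R X)).
Proof.
apply: smallest_sub; first exact: sigma_algebra_measurable.
move=> _ [B [[mB _] _] [Y mY <-]].
exact: (measurable_config_measure hX bV).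
Qed.

Section energy.
Variables (Phi : configuration R X -> \bar R) (PhiP : is_potential Phi).

Lemma measurable_potential_crestrict n :
  measurable_fun setT (fun g : Void R X => Phi (crestrict g (finite_cover n))).
Proof.
move=> _ Y mY; rewrite setTI.
have [_ _ _ /(_ _ (Bc_finite_cover n) Y mY)] := PhiP.
exact: B_Gamma_Void.
Qed.

Section measurable_energy.
Context d (T : measurableType d) (u : T -> Void R X) (L : T -> set X).
Hypothesis mu : measurable_fun setT u.
Hypothesis mL : forall n,
  measurable [set t | hits (L t) (crestrict (u t) (finite_cover n))].

Lemma measurable_esum_hitting (psi : \bar R -> \bar R) :
  measurable_fun setT psi -> (forall x, 0 <= psi x) -> psi 0 = 0 ->
  measurable_fun setT
    (fun t => \esum_(h in hitting_subconfigs (L t) (u t)) psi (Phi h)).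
Proof.
move=> mpsi psi0 psi00.
under eq_fun => t.
  rewrite (esum_hitting_subconfigs _ _ (psi := psi \o Phi)); last 2 first.
  - by move=> h; exact: psi0.
  - by move=> h hinf /=; have [_ _ -> ] := PhiP.
  over.
apply: ge0_emeasurable_sum => [n t _ _|n _].
  by rewrite !mule_ge0 ?lee_fin//=; exact: psi0.
apply: emeasurable_funM.
  apply/measurable_EFinP; apply: measurableT_comp mu.
  by apply: measurable_indic; exact: measurable_carves.
apply: emeasurable_funM.
  apply/measurable_EFinP.
  rewrite (_ : (fun t => _) = (\1_[set t | hits (L t)
    (crestrict (u t) (finite_cover n))] : T -> R)).
    exact: measurable_indic.
  apply/funext => t; rewrite !indicE.
  by have [h|h] := pselect (hits (L t) (crestrict (u t) (finite_cover n)));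
    [rewrite !mem_set|rewrite !memNset].
apply: measurableT_comp => //.
by apply: (measurableT_comp (measurable_potential_crestrict n) mu).
Qed.

Lemma measurable_energy : measurable_fun setT (fun t => energy Phi (L t) (u t)).
Proof.
rewrite /energy.
apply: measurable_fun_ifT.
- apply: (measurable_fun_bool true); rewrite setTI.
  rewrite (_ : _ @^-1` _ = setT `&` [set t |
    \esum_(h in hitting_subconfigs (L t) (u t)) `|Phi h| < +oo]).
    apply: emeasurable_fun_infty_o => //.
    by apply: (@measurable_esum_hitting abse) => //; exact: abse0.
  by rewrite setTI; apply/seteqP; split=> t /asboolP.
- apply: emeasurable_funB; rewrite ?funepos.unlock ?funeneg.unlock.
    apply: (@measurable_esum_hitting (fun x => maxe x 0)).
    + by apply: measurable_maxe.
    + by move=> x; rewrite le_max lexx orbT.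
    + exact: maxxx.
  apply: (@measurable_esum_hitting (fun x => maxe (- x) 0)).
  + by apply: measurable_maxe => //; exact: oppe_measurable.
  + by move=> x; rewrite le_max lexx orbT.
  + by rewrite oppe0 maxxx.
- exact: measurable_cst.
Qed.

End measurable_energy.

End energy.

(** The void event of [U] for the spliced configuration involves the hitting events
of [U] outside and inside Λ, which are measurable for every Borel set. *)
Lemma measurable_splice (Lam : set (borel X)) : measurable Lam ->
  measurable_fun setT
    (fun z : Void R X * Void R X => splice Lam z.1 z.2 : Void R X).
Proof.
move=> mL; apply: (@measurability _ _ _ (Void R X) _ _ (@void_system R X));
  first by [].
move=> _ [_ [U cU <-] <-]; rewrite setTI.
have mU : measurable (U : set (borel X)).
  by apply: sub_sigma_algebra; exact: cozero_open cU.
rewrite (_ : _ @^-1` _ = ~` (hits (U `\` Lam) `*` setT `|` setT `*` hits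
  (U `&` Lam))).
  apply: measurableC; apply: measurableU; apply: measurableX => //;
    apply: measurable_hits_borel; [exact: measurableD|exact: measurableI].
apply/seteqP; split=> -[g h] /= gh.
  by case=> -[]; [move=> [x [gx [Ux Lx]]] _|move=> _ [x [hx [Ux Lx]]]];
  (have : (points (splice Lam g h) `&` U) x by (split; first by [left|right]));
  rewrite gh.
apply/seteqP; split=> // x [[[gx Lx]|[hx Lx]] Ux]; apply: gh.
  by left; split => //; exists x.
by right; split => //; exists x.
Qed.

Lemma measurable_add_point :
  measurable_fun setT (fun z : Void R X * borel X => add_point z.1 z.2 : Void R X).
Proof.
apply: (@measurability _ _ _ (Void R X) _ _ (@void_system R X)); first by [].
move=> _ [_ [U cU <-] <-]; rewrite setTI.
have mU : measurable (U : set (borel X)).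
  by apply: sub_sigma_algebra; exact: cozero_open cU.
rewrite (_ : _ @^-1` _ = ~` (hits U `*` setT `|` setT `*` U)).
  by apply: measurableC; apply: measurableU; apply: measurableX => //;
    exact: measurable_hits_borel.
apply/seteqP; split=> -[g x] /= gx.
  case=> -[]; [move=> [y [gy Uy]] _|move=> _ Ux].
    have h : (points (add_point g x) `&` U) y by split; first by left.
    by move/seteqP: gx => [/(_ _ h)].
  have h : (points (add_point g x) `&` U) x by split; first by right.
  by move/seteqP: gx => [/(_ _ h)].
apply/seteqP; split=> // y [[gy|->] Uy]; apply: gx.
  by left; split => //; exists y.
by right.
Qed.

Section energy_instances.
Variables (Phi : configuration R X -> \bar R) (PhiP : is_potential Phi).

Lemma measurable_energy_set (Lam : set (borel X)) : measurable Lam ->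
  measurable_fun setT (fun g : Void R X => energy Phi Lam g).
Proof.
move=> mL; apply: (@measurable_energy _ PhiP _ (Void R X) id (fun=> Lam)) => // n.
rewrite (_ : [set t | _] = hits (finite_cover n `&` Lam)).
  by apply: measurable_hits_borel; apply: measurableI => //;
    exact: measurable_finite_cover.
by apply/seteqP; split=> g [x]; [move=> [[? ?] ?]|move=> [? [? ?]]]; exists x.
Qed.

(** Joint measurability in the configuration and the point is what permits Fubini
arguments; this is why [measurable_energy] lets the set and the configuration
vary together. *)
Lemma measurable_energy_point :
  measurable_fun setT (fun z : Void R X * borel X =>
    energy Phi [set z.2] (add_point z.1 z.2)).
Proof.
apply: (@measurable_energy _ PhiP _ (Void R X * borel X)%type
  (fun z => add_point z.1 z.2) (fun z => [set z.2])).
  exact: measurable_add_point.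
move=> n.
rewrite (_ : [set t | _] = setT `*` (finite_cover n : set (borel X))).
  by apply: measurableX => //; exact: measurable_finite_cover.
apply/seteqP; split=> -[g x] /=; first by move=> [y [[_ Uy] yx]]; split=> //;
  rewrite -yx.
by move=> [_ Ux]; exists x; split=> //; split=> //; right.
Qed.

End energy_instances.

End finite_subconfigurations.

Section energy_additivity.
Local Open Scope ereal_scope.
Context {R : realType} {X : ptopologicalType}.
Variable Phi : configuration R X -> \bar R.

(** A subconfiguration of γ + ε_x that hits Λ either avoids [x], and is then a
subconfiguration of γ, or contains [x], and then it hits [{x}]; conversely a
subconfiguration containing [x] hits Λ since [x] is in Λ. *)
Lemma esum_hitting_add_point Lam (g : configuration R X) x
    (psi : configuration R X -> \bar R) : Lam x -> ~ points g x ->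
  (forall h, 0 <= psi h) ->
  \esum_(h in hitting_subconfigs Lam (add_point g x)) psi h =
  \esum_(h in hitting_subconfigs Lam g) psi h +
  \esum_(h in hitting_subconfigs [set x] (add_point g x)) psi h.
Proof.
move=> Lx gx psi0.
rewrite (esumID [set h : configuration R X | ~ points h x])//; congr (_ + _);
  congr (esum _ _); apply/seteqP; split=> h; rewrite /hitting_subconfigs /=.
- move=> [[hg hL] hx]; split=> // y hy.
  by have [//|yx] := hg _ hy; rewrite yx in hy.
- move=> [hg hL]; split; last by move=> /hg.
  by split => // y /hg; left.
- move=> [[hg hL] /contrapT hx]; split=> //.
  by rewrite /N_in config_measure_gt0; apply/asboolP; exists x.
- rewrite /N_in !config_measure_gt0 => -[hg /asboolP[y [hy yx]]].
  rewrite yx in hy; split; last by [].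
  by split=> //; apply/asboolP; exists x.
Qed.

(** Energies add up when both sums converge; otherwise one of the factors on the
right and the left side vanish, as an infinite energy has Boltzmann factor 0. *)
Lemma boltzmann_add_point Lam (g : configuration R X) x : Lam x -> ~ points g x ->
  expeR (- energy Phi Lam (add_point g x)) =
  expeR (- energy Phi Lam g) * expeR (- energy Phi [set x] (add_point g x)).
Proof.
move=> Lx gx; rewrite /energy.
set A := hitting_subconfigs Lam (add_point g x).
set B := hitting_subconfigs Lam g.
set C := hitting_subconfigs [set x] (add_point g x).
have ABC psi := @esum_hitting_add_point Lam g x psi Lx gx.
have sABC : summable A Phi = summable B Phi && summable C Phi.
  rewrite /summable ABC//; apply/idP/andP => [|[b c]]; last exact: lte_add_pinfty.
  move=> h; split; apply: le_lt_trans h; [apply: leeDl|apply: leeDr];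
    exact: esum_ge0.
case: (asboolP (summable A Phi)); rewrite sABC.
  move=> /andP[sB sC]; rewrite !asboolT// -expeRD; congr expeR.
  rewrite !ABC//.
  have fin D : summable D Phi -> \esum_(h in D) Phi^\+ h \is a fin_num /\
      \esum_(h in D) Phi^\- h \is a fin_num.
    move=> sD; split.
      by move/summable_funepos: (sD); rewrite summableE;
        under eq_esum do rewrite gee0_abs//.
    by move/summable_funeneg: (sD); rewrite summableE;
      under eq_esum do rewrite gee0_abs//.
  have [bp bn] := fin _ sB; have [cp cn] := fin _ sC.
  rewrite -(fineK bp) -(fineK bn) -(fineK cp) -(fineK cn) -!(EFinD, EFinN).
  by congr EFin; lra.
move=> /negP; rewrite negb_and => /orP[/negP nB|/negP nC].
  by rewrite (asboolF nB) /= mul0e.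
by rewrite (asboolF nC) /= mule0.
Qed.

End energy_additivity.

(** * The vague topology *)

Lemma continuous_borel_measurable (R : realType) (T : ptopologicalType)
  (f : T -> R) : continuous f -> measurable_fun setT (f : borel T -> R).
Proof.
move=> cf; apply: (@measurability _ _ (borel T) R _ _ _ (RGenOInfty.measurableE R)).
move=> _ [_ [x ->] <-]; rewrite setTI; apply: sub_sigma_algebra.
apply: open_comp; last exact: interval_open.
by move=> t _; exact: cf.
Qed.

HB.instance Definition _ (R : realType) (X : topologicalType) :=
  gen_eqMixin (Cc R X).

Section vague.
Context {R : realType} {X : ptopologicalType}.
Implicit Types (g : configuration R X) (f : Cc R X).

Lemma continuous_pairing f :
  continuous (fun g : configuration R X => pairing g f).
Proof.
move=> g.
have cp : continuous (@pairing_Cc R X : configuration R X -> {ptws Cc R X -> R}).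
  exact: initial_continuous.
apply: (@continuous_comp _ _ _ (@pairing_Cc R X)
  (fun u : {ptws Cc R X -> R} => u f)).
  exact: cp.
exact: (@proj_continuous (Cc R X) (fun=> R) f).
Qed.

Lemma measurable_pairing f :
  measurable_fun setT (fun g : Gamma R X => pairing g f).
Proof. exact: continuous_borel_measurable (@continuous_pairing f). Qed.

Lemma pairing_finite g (A : set X) (u : X -> R) : finite_set A ->
  A `<=` points g -> (forall x, points g x -> ~ A x -> u x = 0) ->
  pairing g u = \sum_(x <- fset_set A) u x.
Proof.
move=> fA Ag u0; rewrite /pairing -(@fsbig_widen _ _ _ _ A)//.
  by rewrite fsbig_finite.
by move=> x [gx Ax] /=; rewrite u0.
Qed.

Lemma pairing_Cc_finite g f : finite_set (points g `&` [set x | f x != 0]).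
Proof.
apply: sub_finite_set (points_lf g (@Cc_compact_support _ _ f)) => x [gx fx].
by split=> //; exact: subset_closure.
Qed.

Lemma pairing_CcE g f :
  pairing g f = \sum_(x <- fset_set (points g `&` [set x | f x != 0])) f x.
Proof.
apply: pairing_finite; [exact: pairing_Cc_finite|by move=> x []|].
by move=> x gx /not_andP[//|/negP]; rewrite negbK => /eqP.
Qed.

Lemma pairing_eq0 g f : (forall x, 0 <= f x) ->
  pairing g f = 0 <-> points g `&` [set x | 0 < f x] = set0.
Proof.
move=> f0; rewrite pairing_CcE; split => [/eqP|h].
  rewrite psumr_eq0; last by move=> x _.
  move=> /allP h; apply/seteqP; split=> // x [gx fx].
  have : x \in fset_set (points g `&` [set x | f x != 0]).
    by rewrite in_fset_set ?inE//; [split=> //;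
      exact: lt0r_neq0|exact: pairing_Cc_finite].
  by move=> /h /=; rewrite (gt_eqF fx).
rewrite big1_seq// => x /= ; rewrite in_fset_set; last exact: pairing_Cc_finite.
rewrite inE => -[gx fx].
have : (points g `&` [set x | 0 < f x]) x by split => //=; rewrite lt0r fx f0.
by rewrite h.
Qed.

(** The void event of [{f > 0}] with [f >= 0] is the zero set of the vaguely
continuous function [pairing ^~ f]. *)
Lemma measurable_Gamma_Void :
  measurable_fun setT (id : Gamma R X -> Void R X).
Proof.
apply: (@measurability _ _ (Gamma R X) (Void R X) _ _ (@void_system R X));
  first by [].
move=> _ [_ [_ [f f0 ->] <-] <-].
rewrite (_ : _ `&` _ = setT `&` (fun g : Gamma R X => pairing g f) @^-1` [set 0]).
  exact: measurable_pairing.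
by rewrite !setTI; apply/seteqP; split=> g /=; rewrite pairing_eq0.
Qed.

Lemma measurable_Cc (f : Cc R X) : measurable_fun setT (f : borel X -> R).
Proof. by apply: continuous_borel_measurable; exact: Cc_continuous. Qed.

Lemma measurable_cozero (U : set X) : cozero R X U -> measurable
  (U : set (borel X)).
Proof. by move=> cU; apply: sub_sigma_algebra; exact: cozero_open cU. Qed.

End vague.

Section pairing_measurability.
Context {R : realType} {X : ptopologicalType}.
Implicit Types (g : configuration R X) (f : Cc R X).

Lemma pairing_add_point g f z : ~ points g z ->
  pairing (add_point g z) f = pairing g f + f z.
Proof.
move=> gz; have fin := pairing_Cc_finite g f.
rewrite [in RHS]pairing_CcE.
set A := points g `&` [set x | f x != 0] in fin *.
have zA : z \notin fset_set A by rewrite in_fset_set// notin_setE => -[/gz].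
rewrite (@pairing_finite _ _ _ (z |` A)).
- by rewrite fset_setU1// big_fsetU1//= addrC.
- by rewrite finite_setU; split=> //; exact: finite_set1.
- by move=> x [->|[gx _]]; [right|left].
- move=> x [gx|->] /not_orP[]; last by move=> /(_ erefl).
  by move=> _ /not_andP[//|/negP]; rewrite negbK => /eqP.
Qed.

Lemma pairing_ge0_esum g f : (forall x, 0 <= f x) ->
  (pairing g f)%:E = \esum_(x in points g) (f x)%:E.
Proof.
move=> f0; have fin := pairing_Cc_finite g f.
transitivity (\esum_(x in points g `&` [set x | f x != 0]) (f x)%:E); last first.
  rewrite [LHS]esum_mkcondr; apply: eq_esum => x _.
  by case: ifPn => //; rewrite notin_setE => /negP; rewrite negbK => /eqP ->.
rewrite esum_fset//; last by move=> x _; rewrite lee_fin.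
by rewrite pairing_CcE fsbig_finite// sumEFin.
Qed.

Section measurable.
Hypotheses (hX : hausdorff_space X).
Variables (V : nat -> set X) (bV : cozero_base (R:=R) V).

Let measurable_pairing_ge0 f : (forall x, 0 <= f x) ->
  measurable_fun setT (fun g : Void R X => pairing g f).
Proof.
move=> f0; apply/measurable_EFinP.
rewrite (_ : _ \o _ = fun g : Void R X => \int[config_measure g]_x (f x)%:E)%E.
  apply: (@measurable_integral_config _ _ hX _ bV _ (Void R X) id
    (fun z => (f z.2)%:E)) => //.
    apply/measurable_EFinP; apply: measurableT_comp => //; exact: measurable_Cc.
  by move=> z; rewrite lee_fin.
apply/funext => g /=; rewrite (integral_config_measure hX bV).
- exact: pairing_ge0_esum.
- by apply/measurable_EFinP; exact: measurable_Cc.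
- by move=> x; rewrite lee_fin.
Qed.

(** For nonnegative [f] the pairing is an integral against the counting measure;
the general case follows by splitting [f]. *)
Lemma measurable_pairing_void f :
  measurable_fun setT (fun g : Void R X => pairing g f).
Proof.
have [|u v cu cv|p pE] := @Cc_binop _ _ (fun a _ => Num.max 0 a) f f.
- exact: maxxx.
- by move=> x; apply: (@continuous_max R X (cst 0) u); [exact: cvg_cst|exact: cu].
have [|u v cu cv|q qE] := @Cc_binop _ _ (fun a _ => Num.max 0 (- a)) f f.
- by rewrite oppr0 maxxx.
- move=> x; apply: (@continuous_max R X (cst 0) (fun x => - u x));
    first exact: cvg_cst.
  by apply: (@cvgN _ _ _ (nbhs x)); exact: cu.
rewrite (_ : (fun g => _) = fun g : Void R X => pairing g p - pairing g q).
  apply: measurable_funB; apply: measurable_pairing_ge0 => x.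
    by rewrite pE le_max lexx.
  by rewrite qE le_max lexx.
apply/funext => g; have fin := pairing_Cc_finite g f.
have Ag : points g `&` [set x | f x != 0] `<=` points g by move=> x [].
have off x : points g x -> ~ (points g `&` [set x | f x != 0]) x -> f x = 0.
  by move=> gx /not_andP[//|/negP]; rewrite negbK => /eqP.
rewrite pairing_CcE !(pairing_finite fin Ag).
2: by move=> x gx /(off x gx); rewrite qE => ->; rewrite oppr0 maxxx.
2: by move=> x gx /(off x gx); rewrite pE => ->; rewrite maxxx.
rewrite -sumrB; apply: eq_bigr => x _; rewrite pE qE /=.
have [fx|fx] := leP 0 (f x).
  have -> : Num.max 0 (- f x) = 0 by apply: max_l; rewrite oppr_le0.
  by rewrite subr0.
have -> : Num.max 0 (- f x) = - f x by apply: max_r; rewrite oppr_ge0 ltW.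
by rewrite sub0r opprK.
Qed.

End measurable.

End pairing_measurability.

(** * Void probabilities of the Poisson measure *)

Section poisson.
Context {R : realType} {X : ptopologicalType}.
Variables (V : nat -> set X) (bV : cozero_base (R:=R) V).
Variable sigma : {measure set (borel X) -> \bar R}.
Variables (P : probability (Gamma R X) R) (PP : is_poisson sigma P).

Local Open Scope ereal_scope.

(** If σ(U) were infinite, the Laplace functional at [-h], with [h] bounded below by
a positive constant on [U], would be [exp(-oo) = 0], although it is the integral
of a positive function. *)
Lemma poisson_intensity_lty (U : set X) : cozero R X U -> sigma U < +oo.
Proof.
move=> cU; have [->|/set0P[x0 Ux0]] := eqVneq U set0; first by rewrite measure0.
have cK := cozero_relatively_compact cU.
(* On the closure of [U] the function [h] has a positive minimum [h c]. *)
have [_ [h h0 ->] KW] := compact_sub_cozero bV cK.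
have [|c cK' hc] := compact_EVT_min _ cK (continuous_subspaceT
  (@Cc_continuous _ _ h)).
  by exists x0; exact: subset_closure.
have hc0 : (0 < h c)%R by apply: KW; rewrite inE in cK'.
have [k kE] := Cc_oppr h.
rewrite ltNge leye_eq; apply/negP => /eqP sU.
have := PP k.
have -> : \int[sigma]_x (expR (k x) - 1)%:E = -oo.
  under eq_integral do rewrite -opprB EFinN.
  rewrite integral_ge0N; last first.
    by move=> x _; rewrite lee_fin subr_ge0 kE -expR0 ler_expR oppr_le0.
  apply/eqP; rewrite eqe_oppLR /=; apply/eqP.
  pose e := (1 - expR (- h c))%R.
  have e0 : (0 < e)%R by rewrite subr_gt0 -expR0 ltr_expR oppr_lt0.
  apply/eqP; rewrite -leye_eq.
  apply: (@le_trans _ _ (\int[sigma]_x (e%:E * (\1_U x)%:E))).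
    rewrite ge0_integralZl_EFin//; [|by apply/measurable_EFinP;
      apply: measurable_indic; exact: measurable_cozero cU|exact: ltW].
    rewrite integral_indic//; last exact: measurable_cozero cU.
    by rewrite setIT sU mulry gtr0_sg// mul1e.
  apply: ge0_le_integral => //.
  - by move=> x _; rewrite -EFinM lee_fin mulr_ge0// ltW.
  - by apply/measurable_EFinP; apply: measurable_funM => //;
      apply: measurable_indic; exact: measurable_cozero cU.
  - apply/measurable_EFinP; apply: measurable_funB => //.
    by apply: measurableT_comp => //; exact: measurable_Cc.
  - move=> x _; rewrite -EFinM lee_fin indicE kE.
    have [/set_mem Ux|_] := boolP (x \in U).
      rewrite mulr1 lerB// ler_expR lerN2; apply: hc.
      by apply/mem_set; exact: subset_closure.
    by rewrite mulr0 subr_ge0 -expR0 ler_expR oppr_le0.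
rewrite /= => /eqP.
have mf : measurable_fun setT (fun g : Gamma R X => (expR (pairing g k))%:E).
  by apply/measurable_EFinP; apply: measurableT_comp => //;
    exact: measurable_pairing.
rewrite (_ : \int[P]_g _ = \int[P]_g `|(expR (pairing g k))%:E|); last first.
  by apply: eq_integral => g _; rewrite gee0_abs// lee_fin expR_ge0.
move=> /eqP /(ae_eq_integral_abs P measurableT mf)[N [mN PN hN]].
have : P setT <= P N.
  apply: le_measure; rewrite ?inE// => g _; apply: hN => /= /(_ Logic.I) /eqP.
  by rewrite eqe gt_eqF// expR_gt0.
by rewrite PN probability_setT leNgt lte01.
Qed.

Lemma poisson_sigma_finite : sigma_finite setT sigma.
Proof.
exists V; last first.
  move=> n; split; first exact: measurable_cozero (bV.1 n).
  exact: (poisson_intensity_lty (bV.1 n)).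
apply/seteqP; split=> // x _; have [n Vn] := cozero_base_cover bV x.
by exists n.
Qed.

End poisson.

Section laplace.
Context {R : realType} {X : ptopologicalType}.
Variables (V : nat -> set X) (bV : cozero_base (R:=R) V).
Variable sigma : {measure set (borel X) -> \bar R}.
Variables (P : probability (Gamma R X) R) (PP : is_poisson sigma P).
Implicit Types g : configuration R X.

Definition count_in (B : set X) g : nat := #|` fset_set (points g `&` B)|.

Definition void_on (A : set X) : set (configuration R X) :=
  [set g | points g `&` A = set0].

Lemma finite_in_cozero g (B : set X) : cozero R X B -> finite_set (points g `&` B).
Proof.
move=> cB; apply: sub_finite_set (points_lf g (cozero_relatively_compact cB)).
by move=> x [gx Bx]; split => //; exact: subset_closure.
Qed.

Lemma config_measure_cozero g (B : set (borel X)) : cozero R X B ->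
  config_measure g B = (count_in B g)%:R%:E.
Proof.
move=> cB; rewrite /config_measure /= /counting_on /counting asboolT//.
exact: finite_in_cozero.
Qed.

Section void_generating_function.
Variables (f h : Cc R X).
Hypotheses (f0 : forall x, 0 <= f x) (h0 : forall x, 0 <= h x).
Variable s : R.
Hypotheses (s0 : 0 <= s) (s1 : s < 1).
Let A : set X := [set x | 0 < f x].
Let B : set X := [set x | 0 < h x].
Let cA : cozero R X A. Proof. by exists f. Qed.
Let cB : cozero R X B. Proof. by exists h. Qed.

Let phi_ex n : exists k : Cc R X, forall x,
  k x = ln (1 - s) * Num.min 1 (n%:R * h x) - n%:R * f x.
Proof.
have [|u v cu cv|k kE] := @Cc_binop _ _ (fun a b => ln (1 - s) * Num.min 1
  (n%:R * b) - n%:R * a) f h.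
- by rewrite !mulr0 min_r ?ler01// mulr0 subr0.
- move=> x; apply: (@cvgB R R _ (nbhs x) _
    (fun x => ln (1 - s) * Num.min 1 (n%:R * v x)) (fun x => n%:R * u x)).
    apply: (@cvgM R _ (nbhs x) _ (cst (ln (1 - s)))
      (fun x => Num.min 1 (n%:R * v x))).
      exact: cvg_cst.
    apply: (@continuous_min R X (cst 1) (fun x => n%:R * v x));
      first exact: cvg_cst.
    by apply: (@cvgM R _ (nbhs x) _ (cst n%:R) v); [exact: cvg_cst|exact: cv].
  by apply: (@cvgM R _ (nbhs x) _ (cst n%:R) u); [exact: cvg_cst|exact: cu].
- by exists k.
Qed.

Let phi n : Cc R X := projT1 (cid (phi_ex n)).
Let phiE n x : phi n x = ln (1 - s) * Num.min 1 (n%:R * h x) - n%:R * f x.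
Proof. exact: (projT2 (cid (phi_ex n))). Qed.

Let ln_le0 : ln (1 - s) <= 0.
Proof. by apply: ln_le0; rewrite gerBl. Qed.

Let phi_le0 n x : phi n x <= 0.
Proof.
rewrite phiE subr_le0 (@le_trans _ _ 0)//; last by rewrite mulr_ge0.
by rewrite mulr_le0_ge0// le_min ler01 mulr_ge0.
Qed.

Let phi0 n x : ~ (A `|` B) x -> phi n x = 0.
Proof.
move=> /not_orP[/negP fx /negP hx]; rewrite phiE.
have -> : f x = 0 by apply/eqP; rewrite eq_le f0 andbT leNgt.
have -> : h x = 0 by apply/eqP; rewrite eq_le h0 andbT leNgt.
by rewrite !mulr0 min_r ?ler01// mulr0 subr0.
Qed.

Let l x : R := if 0 < f x then 0 else if 0 < h x then 1 - s else 1.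

Let expR_phi_cvg x : (fun n => expR (phi n x)) @ \oo --> l x.
Proof.
rewrite /l; case: ifPn => [fx|]; last rewrite -leNgt => fx0.
  apply: (@squeeze_cvgr _ _ _ _ (cst 0) (fun n => expR (- f x) ^+ n)).
  - near=> n; rewrite expR_ge0 /= -expRM_natl ler_expR phiE mulrN.
    by rewrite gerDr mulr_le0_ge0// le_min ler01 mulr_ge0.
  - exact: cvg_cst.
  - by apply: cvg_expr; rewrite ger0_norm ?expR_ge0// expR_lt1 oppr_lt0.
have fx : f x = 0 by apply/eqP; rewrite eq_le f0 fx0.
case: ifPn => [hx|]; last rewrite -leNgt => hx0.
  apply: (@cvg_trans _ ((cst (1 - s) : R^nat) @ \oo)); last exact: cvg_cst.
  apply: near_eq_cvg; near=> n; rewrite phiE fx mulr0 subr0 min_l.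
    by rewrite mulr1 lnK// posrE subr_gt0.
  rewrite -ler_pdivrMr//; near: n; exact: nbhs_infty_ger.
have hx : h x = 0 by apply/eqP; rewrite eq_le h0 hx0.
have -> : (fun n => expR (phi n x)) = cst 1; last exact: cvg_cst.
apply/funext => n; rewrite phi0 ?expR0//.
by move=> -[]; rewrite /A /B /= ?fx ?hx ltxx.
Unshelve. all: by end_near. Qed.

(** With [A = {f > 0}] and [B = {h > 0}], the expectation of this variable is the
joint transform of the void event of [A] and the number of points in [B]. *)
Definition void_weight g : R := (\1_(void_on A) g) * (1 - s) ^+ count_in B g.

Let expR_pairing_cvg g : (fun n => expR (pairing g (phi n))) @ \oo -->
  void_weight g.
Proof.
have fin : finite_set (points g `&` (A `|` B)).
  by apply: finite_in_cozero; exact: cozeroU.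
have -> : (fun n => expR (pairing g (phi n))) =
    (fun n => \prod_(x <- fset_set (points g `&` (A `|` B))) expR (phi n x)).
  apply/funext => n; rewrite (pairing_finite fin) ?expR_sum//.
  by move=> x gx /not_andP[//|]; exact: phi0.
have -> : void_weight g = \prod_(x <- fset_set (points g `&` (A `|` B))) l x.
  rewrite /void_weight indicE; have [gA|gA] := pselect (void_on A g).
    rewrite mem_set// mul1r /count_in.
    have -> : points g `&` (A `|` B) = points g `&` B by rewrite setIUr gA set0U.
    rewrite (eq_big_seq (fun=> 1 - s)).
      by rewrite big_const_seq count_predT -Monoid.iteropE /=.
    move=> x; rewrite in_fset_set ?inE; last exact: finite_in_cozero.
    move=> [gx Bx]; rewrite /l; case: ifPn => fx; last by rewrite Bx.
    by have : (points g `&` A) x by []; rewrite gA.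
  rewrite memNset// mul0r; apply/esym.
  have /set0P[x [gx Ax]] : points g `&` A != set0 by apply/eqP.
  rewrite (big_fsetD1 x)/=; last by rewrite in_fset_set// inE; split=> //; left.
  by rewrite /l (_ : 0 < f x)// mul0r.
by apply: (@cvg_prodr R nat \oo _ _ _ (fun x n => expR (phi n x)) l) => x;
  exact: expR_phi_cvg.
Qed.

Local Open Scope ereal_scope.

(** The weight is the limit of the exponentials of pairings with [phi n]. *)
Lemma measurable_void_weight :
  measurable_fun setT (fun g : Gamma R X => (void_weight g)%:E).
Proof.
apply: (emeasurable_fun_cvg (fun n (g : Gamma R X) =>
  (expR (pairing g (phi n)))%:E)).
  move=> n; apply/measurable_EFinP; apply: measurableT_comp => //.
  exact: measurable_pairing.
by move=> g _; apply: cvg_EFin; [exact: nearW|exact: expR_pairing_cvg].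
Qed.

Lemma void_weight_ge0 g : (0 <= void_weight g)%R.
Proof. by rewrite mulr_ge0// exprn_ge0// subr_ge0 ltW. Qed.

(** This is the limit of the Laplace functional along the test functions
[phi n = ln (1 - s) min(1, n h) - n f], whose exponentials decrease to 0 on [A],
to [1 - s] on [B `\` A] and to 1 elsewhere. *)
Lemma integral_void_weight :
  \int[P]_g (void_weight g)%:E =
  (expR (- (fine (sigma A) + s * fine (sigma (B `\` A)))))%:E.
Proof.
have mA := measurable_cozero cA; have mB := measurable_cozero cB.
have sA : sigma A \is a fin_num by rewrite ge0_fin_numE//;
  exact: (poisson_intensity_lty bV PP cA).
have sAB : sigma (A `|` B) < +oo by apply: (poisson_intensity_lty bV PP);
  exact: cozeroU.
have sB : sigma (B `\` A) \is a fin_num.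
  rewrite ge0_fin_numE//; apply: le_lt_trans sAB; apply: le_measure; rewrite ?inE//.
  - exact: measurableD.
  - exact: measurableU.
  - by move=> x [Bx _]; right.
have [_ _ lhs] : [/\ P.-integrable setT (fun g => (void_weight g)%:E),
   [sequence \int[P]_(g in setT) `|(expR (pairing g (phi n)))%:E -
     (void_weight g)%:E|]_n @ \oo --> 0 &
   [sequence \int[P]_(g in setT) (expR (pairing g (phi n)))%:E]_n @ \oo -->
     \int[P]_(g in setT) (void_weight g)%:E].
  apply: (@dominated_convergence _ _ _ P setT measurableT _ _ (cst 1)).
  - move=> n; apply/measurable_EFinP; apply: measurableT_comp => //.
    exact: measurable_pairing.
  - exact: measurable_void_weight.
  - by apply: aeW => g _; apply: cvg_EFin; [exact: nearW|exact: expR_pairing_cvg].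
  - exact: finite_measure_integrable_cst.
  - apply: aeW => g n _; rewrite gee0_abs ?lee_fin ?expR_ge0// -expR0 ler_expR.
    by rewrite pairing_CcE; apply: sumr_le0 => x _.
have [_ _ rhs] : [/\ sigma.-integrable setT (fun x => (l x - 1)%:E),
   [sequence \int[sigma]_(x in setT) `|(expR (phi n x) - 1)%:E - (l x - 1)%:E|]_n
     @ \oo --> 0 &
   [sequence \int[sigma]_(x in setT) (expR (phi n x) - 1)%:E]_n @ \oo -->
     \int[sigma]_(x in setT) (l x - 1)%:E].
  have cl x : (expR (phi n x) - 1)%:E @[n --> \oo] --> (l x - 1)%:E.
    apply: cvg_EFin; first exact: nearW.
    by apply: (@cvgB R R); [exact: expR_phi_cvg|exact: cvg_cst].
  have mphi n : measurable_fun setT (fun x : borel X => (expR (phi n x) - 1)%:E).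
    apply/measurable_EFinP; apply: measurable_funB => //.
    by apply: measurableT_comp => //; exact: measurable_Cc.
  apply: (@dominated_convergence _ _ _ sigma setT measurableT _ _
    (fun x => (\1_(A `|` B) x)%:E)).
  - exact: mphi.
  - by apply: (emeasurable_fun_cvg _ _ mphi) => x _; exact: cl.
  - by apply: aeW => x _; exact: cl.
  - apply/integrableP; split.
      by apply/measurable_EFinP; apply: measurable_indic; exact: measurableU.
    under eq_integral do rewrite gee0_abs ?lee_fin//.
    by rewrite integral_indic ?setIT//; exact: measurableU.
  - apply: aeW => x n _; rewrite abse_EFin lee_fin indicE.
    have [_|/negP] := boolP (x \in A `|` B); last first.
      by rewrite inE => /(phi0 n) ->; rewrite expR0 subrr normr0.
    rewrite ler0_norm ?subr_le0 -?expR0 ?ler_expR// opprB expR0 gerBl expR_ge0//.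
have il : \int[sigma]_x (l x - 1)%:E = (- (fine (sigma A) + s * fine
  (sigma (B `\` A))))%:E.
  under eq_integral do rewrite -opprB EFinN.
  rewrite integral_ge0N; last first.
    move=> x _; rewrite lee_fin subr_ge0 /l; case: ifPn => // _; case: ifPn => // _.
    by rewrite gerBl.
  rewrite EFinN; congr (- _).
  under eq_integral => x _.
    have -> : (1 - l x = \1_A x + s * \1_(B `\` A) x)%R.
      rewrite /l !indicE; case: ifPn => fx.
        by rewrite mem_set// memNset ?subr0 ?mulr0 ?addr0// => -[_]; exact.
      rewrite (memNset (A := A)); last by apply/negP.
      case: ifPn => hx; last first.
        by rewrite subrr memNset ?mulr0 ?addr0// => -[Bx]; move: Bx hx;
          rewrite /B/= => ->.
      by rewrite mem_set ?mulr1 ?add0r ?subKr//; split => //; exact/negP.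
    rewrite EFinD EFinM; over.
  have mBA : measurable_fun setT (fun x : borel X => (\1_(B `\` A) x)%:E : \bar R).
    by apply/measurable_EFinP; apply: measurable_indic; exact: measurableD.
  rewrite ge0_integralD; [|exact: measurableT| | | | exact: emeasurable_funM].
  2: by move=> x _; rewrite lee_fin.
  2: by apply/measurable_EFinP; exact: measurable_indic.
  2: by move=> x _; rewrite -EFinM lee_fin mulr_ge0.
  rewrite ge0_integralZl_EFin//.
  rewrite !integral_indic ?setIT//; last exact: measurableD.
  by rewrite EFinD EFinM !fineK.
apply: (@cvg_unique _ (@ereal_hausdorff R) _ _ _ _ lhs).
have -> : [sequence \int[P]_(g in setT) (expR (pairing g (phi n)))%:E]_n =
   (fun n => expeR (\int[sigma]_x (expR (phi n x) - 1)%:E)).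
  by apply/funext => n /=; exact: PP.
rewrite il in rhs; have [finr cvgr] := (fine_cvgP _ _).1 rhs.
apply: (@cvg_trans _ ((fun n => (expR (fine
  (\int[sigma]_x (expR (phi n x) - 1)%:E)))%:E) @ \oo)).
  apply: near_eq_cvg; near=> n; rewrite -[in RHS](@fineK _ (\int[sigma]_x _))//.
  by near: n.
apply: cvg_EFin; first exact: nearW.
by apply: (@continuous_cvg _ _ _ _ _ _ (@expR R)) => //; exact: continuous_expR.
Unshelve. all: by end_near. Qed.

End void_generating_function.
End laplace.

Section void_count.
Context {R : realType} {X : ptopologicalType}.
Variables (V : nat -> set X) (bV : cozero_base (R:=R) V).
Variable sigma : {measure set (borel X) -> \bar R}.
Variables (P : probability (Gamma R X) R) (PP : is_poisson sigma P).
Variables (f h : Cc R X).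
Hypotheses (f0 : forall x, 0 <= f x) (h0 : forall x, 0 <= h x).
Let A : set X := [set x | 0 < f x].
Let B : set X := [set x | 0 < h x].
Let a := fine (sigma A).
Let D := fine (sigma (B `\` A)).

(* Parameters tending to 0; the shift by one keeps them below 1. *)
Let s_ (k : nat) : R := harmonic k.+1.

Let s_gt0 k : 0 < s_ k. Proof. by rewrite /s_ /harmonic /= invr_gt0. Qed.
Let s_lt1 k : s_ k < 1. Proof. by rewrite /s_ /harmonic /= invf_lt1// ltr1n. Qed.

Let s_cvg : s_ @ \oo --> 0.
Proof. by have := @cvg_harmonic R; rewrite -cvg_shiftS. Qed.

Let G k (g : configuration R X) : R :=
  \1_(void_on A) g * \sum_(j < count_in B g) (1 - s_ k) ^+ j.

Let sG k g : s_ k * G k g = void_weight f h 0 g - void_weight f h (s_ k) g.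
Proof.
rewrite /G /void_weight subr0 expr1n mulrCA -mulrBr; congr (_ * _).
have := subrXX 1 (1 - s_ k) (count_in B g).
rewrite subKr expr1n => ->; congr (_ * _).
by apply: eq_bigr => i _; rewrite expr1n mul1r.
Qed.

Let quot_cvg : (fun k => (expR (- a) - expR (- (a + s_ k * D))) / s_ k) @ \oo -->
  expR (- a) * D.
Proof.
have D0 : 0 <= D by rewrite fine_ge0.
have den k : 0 < 1 + s_ k * D by rewrite ltr_pwDl// mulr_ge0// ltW.
have E k : (expR (- a) - expR (- (a + s_ k * D))) / s_ k =
    expR (- a) * ((1 - expR (- (s_ k * D))) / s_ k).
  by rewrite opprD expRD -[X in X - _]mulr1 -mulrBr mulrA.
under eq_fun do rewrite E.
apply: cvgM; first exact: cvg_cst.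
(* The bounds come from [1 - x <= exp (- x) <= 1 / (1 + x)]. *)
apply: (@squeeze_cvgr _ _ _ _ (fun k => D / (1 + s_ k * D)) (cst D)).
- near=> k; apply/andP; split; last first.
    rewrite ler_pdivrMr// lerBlDl addrC -lerBlDl.
    by have := expR_ge1Dx (- (s_ k * D)); rewrite (mulrC D).
  rewrite ler_pdivlMr// mulrAC ler_pdivrMr//.
  rewrite expRN; have h1 := expR_ge1Dx (s_ k * D).
  have : (expR (s_ k * D))^-1 <= (1 + s_ k * D)^-1 by rewrite lef_pV2 ?posrE
    ?expR_gt0.
  move=> /(ler_wpM2r (ltW (den k))); rewrite mulVf ?gt_eqF// => h2.
  by rewrite mulrBl mul1r; lra.
- rewrite -[X in _ --> X](_ : D / (1 + 0 * D) = D);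
    last by rewrite mul0r addr0 divr1.
  apply: cvgM; first exact: cvg_cst.
  apply: cvgV; first by rewrite mul0r addr0 oner_neq0.
  apply: cvgD; first exact: cvg_cst.
  by apply: cvgM => //; exact: cvg_cst.
- exact: cvg_cst.
Unshelve. all: by end_near. Qed.

Let cvg_G g : (fun k => G k g) @ \oo --> (\1_(void_on A) g * (count_in B g)%:R : R).
Proof.
apply: cvgM; first exact: cvg_cst.
elim: (count_in B g) => [|n IH].
  by under eq_fun do rewrite big_ord0; exact: cvg_cst.
under eq_fun do rewrite big_ord_recr /=; rewrite -natr1.
apply: cvgD => //; rewrite -[X in _ --> X](expr1n _ n).
elim: n {IH} => [|n IH].
  by under eq_fun do rewrite expr0; rewrite expr0; exact: cvg_cst.
under eq_fun do rewrite exprS; rewrite exprS.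
apply: cvgM => //; rewrite -[X in _ --> X]subr0; apply: cvgB => //; exact: cvg_cst.
Qed.

Local Open Scope ereal_scope.

Let measurable_G k : measurable_fun setT (fun g : Gamma R X => (G k g)%:E).
Proof.
have -> : (fun g : Gamma R X => (G k g)%:E) =
    (fun g => ((void_weight f h 0 g - void_weight f h (s_ k) g) / s_ k)%:E).
  by apply/funext => g; rewrite -sG mulrAC mulfV ?mul1r// gt_eqF.
apply/measurable_EFinP; apply: measurable_funM => //.
by apply: measurable_funB; apply/measurable_EFinP;
  apply: measurable_void_weight => //; exact: ltW.
Qed.

Let G_ge0 k g : (0 <= G k g)%R.
Proof.
by rewrite mulr_ge0// sumr_ge0// => j _; rewrite exprn_ge0// subr_ge0 ltW.
Qed.

Lemma integral_void_weight0 : \int[P]_g (\1_(void_on A) g)%:E = (expR (- a))%:E.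
Proof.
have := integral_void_weight bV PP f0 h0 (lexx 0) ltr01.
rewrite mul0r addr0 => <-; apply: eq_integral => g _.
by rewrite /void_weight subr0 expr1n mulr1.
Qed.

(** The derivative at [s = 0] of [integral_void_weight]; the difference quotients
[G k] increase with [k], so monotone convergence applies. *)
Lemma integral_void_count :
  \int[P]_g ((\1_(void_on A) g)%:E * (count_in B g)%:R%:E) = (expR (- a) * D)%:E.
Proof.
have IG k : \int[P]_g (G k g)%:E = ((expR (- a) - expR (- (a + s_ k * D))) / s_
  k)%:E.
  have e : \int[P]_g (void_weight f h 0 g)%:E =
      (s_ k)%:E * \int[P]_g (G k g)%:E + \int[P]_g (void_weight f h (s_ k) g)%:E.
    rewrite -ge0_integralZl_EFin//; last 2 first.
    - by move=> g _; rewrite lee_fin.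
    - exact: ltW.
    rewrite -ge0_integralD//; last 4 first.
    - by move=> g _; rewrite -EFinM lee_fin mulr_ge0// ltW.
    - exact: emeasurable_funM.
    - by move=> g _; rewrite lee_fin; apply: void_weight_ge0.
    - by apply: measurable_void_weight => //; exact: ltW.
    by apply: eq_integral => g _; rewrite -EFinM sG -EFinD subrK.
  rewrite !(integral_void_weight bV PP f0 h0)// in e; last exact: ltW.
  rewrite mul0r addr0 in e.
  have : 0 <= \int[P]_g (G k g)%:E by apply: integral_ge0 => g _; rewrite lee_fin.
  move: e; case: (\int[P]_g (G k g)%:E) => [r| |//].
    rewrite -EFinM -EFinD => -[e] _; congr EFin.
    by rewrite /a /D e addrK mulrAC mulfV ?mul1r// gt_eqF.
  by rewrite mulry gtr0_sg// mul1e.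
have : \int[P]_g (G k g)%:E @[k --> \oo] -->
    \int[P]_g ((\1_(void_on A) g)%:E * (count_in B g)%:R%:E).
  have -> : \int[P]_g ((\1_(void_on A) g)%:E * (count_in B g)%:R%:E) =
      \int[P]_g (limn (fun k => (G k g)%:E)).
    apply: eq_integral => g _; apply/esym/cvg_lim => //.
    by rewrite -EFinM; apply: cvg_EFin; [exact: nearW|exact: cvg_G].
  apply: cvg_monotone_convergence => //.
  - by move=> k g _; rewrite lee_fin.
  - move=> g _ j k jk; rewrite lee_fin ler_wpM2l// ler_sum// => i _.
    apply: lerXn2r; [by rewrite nnegrE subr_ge0 ltW|by rewrite nnegrE subr_ge0
      ltW|].
    by rewrite lerB// /s_ /harmonic /= lef_pV2 ?posrE// ler_nat.
under eq_fun do rewrite IG.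
move=> /cvg_unique; apply; first exact: ereal_hausdorff.
by apply: cvg_EFin; [exact: nearW|exact: quot_cvg].
Qed.

End void_count.

(** * Densities and images of measures *)

Section density.
Local Open Scope ereal_scope.
Context d (T : measurableType d) (R : realType).
Variables (m : {measure set T -> \bar R}) (w : T -> \bar R).
Hypotheses (w0 : forall x, 0 <= w x) (mw : measurable_fun setT w).

Definition density (A : set T) : \bar R := \int[m]_(x in A) w x.

Let density0 : density set0 = 0. Proof. exact: integral_set0. Qed.

Let density_ge0 A : 0 <= density A. Proof. exact: integral_ge0. Qed.

Let density_sigma_additive : semi_sigma_additive density.
Proof.
move=> F mF tF mUF; rewrite /density ge0_integral_bigcup//; last first.
  exact: measurable_funS mw.
by apply: is_cvg_nneseries => n _ _; exact: integral_ge0.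
Qed.

HB.instance Definition _ := isMeasure.Build _ _ _ density
  density0 density_ge0 density_sigma_additive.

Definition density_measure : {measure set T -> \bar R} := density.

Import HBNNSimple.

Let integral_density_nnsfun (f : {nnsfun T >-> R}) :
  \int[density_measure]_x (f x)%:E = \int[m]_x ((f x)%:E * w x).
Proof.
transitivity (\sum_(k \in range f) k%:E * \int[m]_(x in f @^-1` [set k]) w x).
  under eq_integral do rewrite fimfunE -fsumEFin//.
  rewrite ge0_integral_fsum//; last 2 first.
  - by move=> y; apply/measurable_EFinP; exact: measurable_funM.
  - by move=> y x _; rewrite nnfun_muleindic_ge0.
  apply: eq_fsbigr => r _; rewrite integralZl_indic_nnsfun// integral_indic//=.
  by rewrite setIT.
transitivity (\int[m]_x (\sum_(k \in range f)
  (k%:E * (\1_(f @^-1` [set k]) x)%:E * w x))).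
  rewrite ge0_integral_fsum//; last 2 first.
  - move=> y; apply: emeasurable_funM => //; apply: emeasurable_funM => //.
    exact/measurable_EFinP.
  - by move=> y x _; rewrite mule_ge0// nnfun_muleindic_ge0.
  apply: eq_fsbigr => r _; have [r0|r0] := leP 0%R r; last first.
    rewrite preimage_nnfun0// integral_set0 mule0; apply/esym/integral0_eq => x _.
    by rewrite indic0 mule0 mul0e.
  under [RHS]eq_integral do rewrite -muleA.
  rewrite ge0_integralZl_EFin//; last 2 first.
  - by move=> x _; rewrite mule_ge0// lee_fin.
  - by apply: emeasurable_funM => //; exact/measurable_EFinP.
  congr (_ * _); rewrite integral_mkcond; apply: eq_integral => x _.
  by rewrite epatch_indic muleC.
apply: eq_integral => x _; rewrite fimfunE -fsumEFin//.
rewrite ge0_mule_fsuml// => y; exact: nnfun_muleindic_ge0.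
Qed.

(** Both sides agree on simple functions, and the general case follows by monotone
convergence. *)
Lemma integral_density (f : T -> \bar R) : measurable_fun setT f ->
  (forall x, 0 <= f x) ->
  \int[density_measure]_x f x = \int[m]_x (f x * w x).
Proof.
move=> mf f0; pose f_ := nnsfun_approx measurableT mf.
have fcvg x : (f_ n x)%:E @[n --> \oo] --> f x by apply: cvg_nnsfun_approx.
have nd x : {homo (fun n => (f_ n x)%:E) : n k / (n <= k)%N >-> n <= k}.
  by move=> n k nk; rewrite lee_fin; exact/lefP/nd_nnsfun_approx.
transitivity (limn (fun n => \int[density_measure]_x (f_ n x)%:E)).
  rewrite -monotone_convergence//.
  - by apply: eq_integral => x _; apply/esym/cvg_lim.
  - by move=> n; exact/measurable_EFinP.
  - by move=> n x _; rewrite lee_fin.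
under eq_fun do rewrite integral_density_nnsfun.
rewrite -monotone_convergence//.
- apply: eq_integral => x _; apply/cvg_lim => //.
  (* Multiplication is discontinuous at 0 * +oo only, which is excluded first. *)
  have [fx|fx] := eqVneq (f x) 0.
    rewrite fx mul0e (_ : (fun n => _) = cst 0); first exact: cvg_cst.
    apply/funext => n; rewrite (_ : f_ n x = 0%R) ?mul0e//.
    have : (f_ n x)%:E <= f x by rewrite /f_ nnsfun_approxE; exact: le_approx.
    by rewrite fx lee_fin => fn0; apply/eqP; rewrite eq_le fun_ge0 fn0.
  have [wx|wx] := eqVneq (w x) 0.
    rewrite wx mule0 (_ : (fun n => _) = cst 0); first exact: cvg_cst.
    by apply/funext => n; rewrite mule0.
  apply: cvgeM => //; last exact: cvg_cst.
  by apply: neq0_mule_def; rewrite mule_eq0 negb_or fx wx.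
- move=> n; apply: emeasurable_funM => //; exact/measurable_EFinP.
- by move=> n x _; rewrite mule_ge0// lee_fin.
- by move=> x _ n k nk; rewrite lee_wpmul2r//; exact: nd.
Qed.

End density.

Section pushforward_as_measure.
Context d d' (T1 : measurableType d) (T2 : measurableType d') (R : realType).
Variables (m : {measure set T1 -> \bar R}) (f : T1 -> T2).
Hypothesis mf : measurable_fun setT f.

Definition pushmeasure : {measure set T2 -> \bar R} :=
  measure_function_pushforward__canonical__measure_function_Measure m mf.

Lemma integral_pushmeasure (h : T2 -> \bar R) : measurable_fun setT h ->
  (forall y, (0 <= h y)%E) ->
  (\int[pushmeasure]_y h y = \int[m]_x h (f x))%E.
Proof.
by move=> mh h0; rewrite /pushmeasure ge0_integral_pushforward.
Qed.

End pushforward_as_measure.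

(** * The Mecke formula *)

Section void_law.
Context {R : realType} {X : ptopologicalType}.
Variable P : probability (Gamma R X) R.

Let id_mixin := isMeasurableFun.Build _ _ _ _ _ (@measurable_Gamma_Void R X).
Let id_mfun : {mfun Gamma R X >-> Void R X} := HB.pack
  (id : Gamma R X -> Void R X) id_mixin.

(** [P] is seen on the σ-algebra of void events so that, on the product with [X],
measures can be compared on the rectangles of [rectanglesE]. *)
Definition void_law : probability (Void R X) R := distribution P id_mfun.

Lemma integral_void_law (h : configuration R X -> \bar R) :
  measurable_fun setT (h : Void R X -> \bar R) -> (forall g, (0 <= h g)%E) ->
  (\int[void_law]_g h g = \int[P]_g h g)%E.
Proof.
move=> mh h0.
exact: (ge0_integral_pushforward (@measurable_Gamma_Void R X) P measurableT mh).
Qed.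

End void_law.

Section mecke.
Context {R : realType} {X : ptopologicalType}.
Hypotheses (hX : hausdorff_space X).
Variables (V : nat -> set X) (bV : cozero_base (R:=R) V).
Variable sigma : {sigma_finite_measure set (borel X) -> \bar R}.
Variables (P : probability (Gamma R X) R) (PP : is_poisson sigma P).
Local Open Scope ereal_scope.

Definition rectangles : set (set (Void R X * borel X)) :=
  [set A `*` B | A in @void_system R X & B in cozero R X].

Let exhaustion n : set X := \big[setU/set0]_(i < n) V i.

Let exhaustion_cozero n : cozero R X (exhaustion n).
Proof. by apply: cozero_bigsetU => i; exact: bV.1. Qed.

Let exhaustion_cover : \bigcup_n exhaustion n = setT.
Proof.
apply/seteqP; split=> // x _; have [n Vn] := cozero_base_cover bV x.
exists n.+1 => //; rewrite /exhaustion -bigcup_mkord; exists n => //=.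
Qed.

Lemma void_system_setT : @void_system R X setT.
Proof.
by exists set0; [exact: cozero0|apply/seteqP; split=> g //= _; rewrite setI0].
Qed.

(** The cozero sets exhaust the space, so cylinders over void events are countable
unions of rectangles. *)
Lemma rectanglesE : @measurable _ (Void R X * borel X)%type = <<s rectangles >>.
Proof.
apply/seteqP; split; last first.
  apply: smallest_sub; first exact: sigma_algebra_measurable.
  move=> _ [A vA] [B cB] <-; apply: measurableX; first exact: sub_sigma_algebra.
  exact: measurable_cozero cB.
rewrite measurable_prod_measurableType.
apply: smallest_sub; first exact: smallest_sigma_algebra.
have hA A : measurable (A : set (Void R X)) -> <<s rectangles >> (A `*` setT).
  pose S := [set A : set (configuration R X) | <<s rectangles >>
    (A `*` (setT : set X))].
  apply: (@smallest_sub _ _ _ S); last first.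
    move=> B vB; rewrite /S /= -exhaustion_cover setX_bigcupr.
    apply: sigma_algebra_bigcup => n; apply: sub_sigma_algebra.
    by exists B => //; exists (exhaustion n) => //; exact: exhaustion_cozero.
  split=> [|B sB|F sF].
  - by rewrite /S /= set0X; exact: sigma_algebra0.
  - rewrite /S /= (_ : _ `*` _ = setT `\` (B `*` setT));
      first exact: sigma_algebraCD.
    by apply/seteqP; split=> -[g x] /=; tauto.
  - by rewrite /S /= setX_bigcupl; exact: sigma_algebra_bigcup.
have hB B : measurable (B : set (borel X)) -> <<s rectangles >> (setT `*` B).
  pose S := [set B : set X | <<s rectangles >>
    ((setT : set (configuration R X)) `*` B)].
  rewrite (borel_cozeroE bV).
  apply: (@smallest_sub _ _ _ S); last first.
    move=> C cC; apply: sub_sigma_algebra; exists setT;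
      first exact: void_system_setT.
    by exists C.
  split=> [|C sC|F sF].
  - by rewrite /S /= setX0; exact: sigma_algebra0.
  - rewrite /S /= (_ : _ `*` _ = setT `\` (setT `*` C));
      first exact: sigma_algebraCD.
    by apply/seteqP; split=> -[g x] /=; tauto.
  - by rewrite /S /= setX_bigcupr; exact: sigma_algebra_bigcup.
move=> _ [A mA] [B mB] <-.
rewrite (_ : A `*` B = (A `*` setT) `&` (setT `*` B)).
  have sI := @measurableI _ (g_sigma_algebraType rectangles).
  by apply: sI; [exact: hA|exact: hB].
by apply/seteqP; split=> -[g x] /=; tauto.
Qed.

Let pair_point n (g : Void R X) : Void R X * borel X := (g, isolated_point V n g).

Let measurable_pair_point n : measurable_fun setT (pair_point n).
Proof.
apply: measurable_fun_pair => //; exact: measurable_isolated_point.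
Qed.

Let w n (g : Void R X) : \bar R := (\1_(isolates V n) g)%:E.

Let w0 n g : 0 <= w n g. Proof. by rewrite lee_fin. Qed.

Let mw n : measurable_fun setT (w n).
Proof.
by apply/measurable_EFinP; apply: measurable_indic;
  exact: (measurable_isolates hX bV).
Qed.

(** The Campbell measure of [P], which integrates [h] into the expectation of
[Σ_{x in γ} h(γ, x)].  The enumeration of γ presents it as a series of images of
measures with densities. *)
Definition campbell : {measure set (Void R X * borel X) -> \bar R} :=
  mseries (fun n => pushmeasure (density_measure (void_law P) (@w0 n) (@mw n))
    (@measurable_pair_point n)) 0.

Lemma integral_campbell (h : Void R X * borel X -> \bar R) :
  measurable_fun setT h -> (forall z, 0 <= h z) ->
  \int[campbell]_z h z =
  \int[void_law P]_g \int[config_measure g]_x h (g, x).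
Proof.
move=> mh h0.
rewrite ge0_integral_measure_series//.
transitivity (\sum_(n <oo) \int[void_law P]_g (h (pair_point n g) * w n g)).
  apply: eq_eseriesr => n _; rewrite integral_pushmeasure// integral_density//.
  exact: measurableT_comp.
rewrite -integral_nneseries//; last 2 first.
- move=> n; apply: emeasurable_funM; last exact: mw.
  exact: measurableT_comp.
- by move=> n g _; rewrite mule_ge0.
apply: eq_integral => g _; rewrite (integral_config_measure hX bV)//; last first.
  exact: measurableT_comp.
rewrite (esum_isolated_point hX bV)//; apply: eq_eseriesr => n _.
by rewrite muleC.
Qed.

Let add_pair (z : Void R X * borel X) : Void R X * borel X :=
  (add_point z.1 z.2, z.2).

Let measurable_add_pair : measurable_fun setT add_pair.
Proof.
by apply: measurable_fun_pair => //; exact: (measurable_add_point hX bV).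
Qed.

(** The Campbell measure that the Mecke formula predicts. *)
Definition reduced_campbell : {measure set (Void R X * borel X) -> \bar R} :=
  pushmeasure (void_law P \x sigma)%E measurable_add_pair.

(** Adding [x] to γ preserves avoidance of [A] iff [x] is not in [A]; both sides
therefore equal [P(γ avoids A) σ(B \ A)], the left one by [integral_void_count]. *)
Lemma campbell_rectangles S : rectangles S -> campbell S = reduced_campbell S.
Proof.
move=> [_ [A cA <-]] [B cB <-].
have mA := measurable_cozero cA; have mB := measurable_cozero cB.
have mvA : measurable (void_on A : set (Void R X)).
  by apply: sub_sigma_algebra; exists A.
have [f f0 Af] := cA; have [h h0 Bh] := cB.
have -> : reduced_campbell ([set g : configuration R X | points g `&` A = set0]
  `*` B) =
    P (void_on A) * sigma (B `\` A).
  rewrite /reduced_campbell /= /pushforward.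
  rewrite (_ : _ @^-1` _ = void_on A `*` (B `\` A)).
    by rewrite product_measure1E//; exact: measurableD.
  apply/seteqP; split=> -[g x] /=.
    rewrite setIUl setU_eq0 => -[[gA xA] Bx]; split=> //; split=> // Ax.
    by have : ([set x] `&` A) x by []; rewrite xA.
  move=> [gA [Bx Ax]]; split => //; rewrite setIUl setU_eq0; split=> //.
  by apply/seteqP; split=> // y [-> ].
have -> : campbell ([set g : configuration R X | points g `&` A = set0] `*` B) =
    \int[P]_g ((\1_(void_on A) g)%:E * (count_in B g)%:R%:E).
  rewrite -(setIT (_ `*` _)) -integral_indic//; last exact: measurableX.
  rewrite integral_campbell//; last first.
    by apply/measurable_EFinP; apply: measurable_indic; exact: measurableX.
  transitivity (\int[void_law P]_g ((\1_(void_on A) g)%:E * config_measure g B)).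
    apply: eq_integral => g _.
    under eq_integral => x _.
      rewrite (_ : \1_(_ `*` _) (g, x) = \1_(void_on A) g * \1_B x)%R; last first.
        by rewrite !indicE in_setX -natrM mulnb.
      rewrite EFinM; over.
    rewrite ge0_integralZl_EFin//; last first.
      by apply/measurable_EFinP; exact: measurable_indic.
    by rewrite integral_indic// setIT.
  rewrite integral_void_law.
  - by apply: eq_integral => g _; rewrite config_measure_cozero.
  - apply: emeasurable_funM; last exact: (measurable_config_measure hX bV).
    by apply/measurable_EFinP; exact: measurable_indic.
  - by move=> g; rewrite mule_ge0// lee_fin.
have sBA : sigma (B `\` A) \is a fin_num.
  rewrite ge0_fin_numE//; apply: le_lt_trans (poisson_intensity_lty bV PP cB).
  by apply: le_measure; rewrite ?inE//; exact: measurableD.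
rewrite Bh Af (integral_void_count bV PP f0 h0) EFinM -Bh -Af fineK//;
  congr (_ * _).
have := integral_void_weight0 bV PP f0 h0.
have mvA' : measurable (void_on A : set (Gamma R X)).
  by rewrite -[void_on A]setTI; exact: (measurable_Gamma_Void measurableT mvA).
by rewrite -Af integral_indic ?setIT.
Qed.

(** The Campbell measures agree on a generating π-system and are finite on an
exhausting sequence of it. *)
Theorem mecke (h : Void R X * borel X -> \bar R) :
  measurable_fun setT h -> (forall z, 0 <= h z) ->
  \int[void_law P]_g \int[config_measure g]_x h (g, x) =
  \int[void_law P]_g \int[sigma]_x h (add_point g x, x).
Proof.
move=> mh h0; rewrite -integral_campbell//.
have e S : measurable S -> campbell S = reduced_campbell S.
  apply: (measure_unique rectangles (fun n => setT `*` exhaustion n)).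
  - exact: rectanglesE.
  - move=> _ _ [A vA] [B cB] <- [A' vA'] [B' cB'] <-; rewrite -setXI.
    exists (A `&` A'); first exact: void_system_setI.
    by exists (B `&` B') => //; exact: cozeroI.
  - move=> n; exists setT; first exact: void_system_setT.
    by exists (exhaustion n).
  - by rewrite -setX_bigcupr exhaustion_cover setXTT.
  - exact: campbell_rectangles.
  - move=> n; rewrite campbell_rectangles; last first.
      exists setT; first exact: void_system_setT.
      by exists (exhaustion n).
    have mE := measurable_cozero (exhaustion_cozero n).
    rewrite /reduced_campbell /= /pushforward.
    rewrite (_ : _ @^-1` _ = setT `*` exhaustion n); last first.
      by apply/seteqP; split=> -[g x].
    rewrite product_measure1E//.
    rewrite [X in X * _](_ : _ = 1); last exact:
      (@probability_setT _ _ _ (void_law P)).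
    rewrite mul1e; exact: (poisson_intensity_lty bV PP).
rewrite (eq_measure_integral reduced_campbell); last by move=> S mS _; exact: e.
rewrite /reduced_campbell integral_pushmeasure// fubini_tonelli1//.
by apply: measurableT_comp.
Qed.

End mecke.

(** * The Georgii-Nguyen-Zessin formula *)

Lemma measurable_point (X : ptopologicalType) (x : X) : hausdorff_space X ->
  measurable ([set x] : set (borel X)).
Proof.
move=> hX; rewrite -[[set x]]setCK; apply: measurableC; apply: sub_sigma_algebra.
by apply: closed_openC; exact: accessible_closed_set1 (hausdorff_accessible hX) _.
Qed.

Section gnz.
Context {R : realType} {X : ptopologicalType}.
Hypotheses (hX : hausdorff_space X).
Variables (V : nat -> set X) (bV : cozero_base (R:=R) V).
Variable sigma : {sigma_finite_measure set (borel X) -> \bar R}.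
Hypothesis sigma1 : forall x, sigma [set x] = 0%E.
Variables (P : probability (Gamma R X) R) (PP : is_poisson sigma P).
Variables (Phi : configuration R X -> \bar R) (PhiP : is_potential Phi).
Variables (mu : probability (Gamma R X) R) (muP : gibbs Phi P mu).
Local Open Scope ereal_scope.

(** σ charges no point and a configuration is countable; the points already present
in a configuration do not matter when one is added at random. *)
Lemma configuration_negligible (g : configuration R X) : sigma.-negligible
  (points g).
Proof.
have : sigma.-negligible (\bigcup_n [set isolated_point V n g]).
  apply: negligible_bigcup => n; exists [set isolated_point V n g].
  by split; [exact: measurable_point|exact: sigma1|].
apply: negligibleS => x gx.
by have [_ _ /(_ x gx)[n _ <-]] := isolated_point_bij hX bV g; exists n.
Qed.

Section fixed_volume.
Variables (Lam : set (borel X)) (LamO : Oc Lam).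

Let mLam : measurable Lam. Proof. by apply: sub_sigma_algebra; exact: LamO.1. Qed.

Definition boltzmann (g : configuration R X) : \bar R := expeR (- energy Phi Lam g).

Lemma measurable_boltzmann : measurable_fun setT (boltzmann : Void R X -> \bar R).
Proof.
apply: (measurableT_comp (@measurable_expeR R)).
apply: (measurableT_comp (@oppe_measurable R setT)).
exact: (measurable_energy_set hX bV PhiP).
Qed.

Let measurable_boltzmann_splice :
  measurable_fun setT (fun z : Void R X * Void R X => boltzmann
    (splice Lam z.1 z.2)).
Proof.
exact: (measurableT_comp measurable_boltzmann (measurable_splice hX bV mLam)).
Qed.

Let splice_section (g : configuration R X) :
  measurable_fun setT (fun g' : Void R X => splice Lam g g' : Void R X).
Proof. exact: (measurable_fun_pair2 (g : Void R X)
  (measurable_splice hX bV mLam)). Qed.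

Let Z := partition_function Phi P Lam.

Let ZE g : Z g = \int[void_law P]_g' boltzmann (splice Lam g g').
Proof.
rewrite integral_void_law//; last by move=> g'; exact: expeR_ge0.
exact: (measurableT_comp measurable_boltzmann (splice_section g)).
Qed.

Let mZ : measurable_fun setT (Z : Void R X -> \bar R).
Proof.
rewrite (_ : Z = fun g => \int[void_law P]_g' boltzmann (splice Lam g g'));
  last first.
  by apply/funext => g; exact: ZE.
apply: (measurable_fun_fubini_tonelli_F (fun z : Void R X * Void R X => boltzmann
  (splice Lam z.1 z.2))) => //.
by move=> z; exact: expeR_ge0.
Qed.

(** The prefactor of [specification]. *)
Definition normalization g : R :=
  (\1_[set eta | (partition_function Phi P Lam eta < +oo)%E] g *
    (fine (partition_function Phi P Lam g))^-1)%R.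

Lemma normalization_ge0 g : (0 <= normalization g)%R.
Proof.
rewrite mulr_ge0// invr_ge0 fine_ge0// integral_ge0// => g' _; exact: expeR_ge0.
Qed.

Lemma measurable_normalization : measurable_fun setT
  (normalization : Void R X -> R).
Proof.
apply: measurable_funM.
  apply: measurable_indic; rewrite -[[set eta | _]]setTI.
  exact: emeasurable_fun_infty_o.
(* On nonnegative numbers the inverse is the power -1, a measurable function. *)
rewrite (_ : (fun g => _) = fun g => powR (fine (Z g)) (-1)); last first.
  by apply/funext => g; rewrite powR_inv1// fine_ge0// integral_ge0// => g' _;
    exact: expeR_ge0.
apply: (measurableT_comp (@measurable_powR R (-1))).
by apply: measurableT_comp.
Qed.

Let w (z : Void R X * Void R X) : \bar R :=
  (normalization z.1)%:E * boltzmann (splice Lam z.1 z.2).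

Let w0 z : 0 <= w z.
Proof. by rewrite mule_ge0// ?lee_fin ?normalization_ge0//; exact: expeR_ge0. Qed.

Let mw : measurable_fun setT w.
Proof.
apply: emeasurable_funM => //; apply/measurable_EFinP.
by apply: (measurableT_comp measurable_normalization).
Qed.

(** The law of the configuration obtained from a μ-distributed γ by resampling the
points in Λ with the density prescribed by the energy. *)
Definition dlr_measure : {measure set (Void R X) -> \bar R} :=
  pushmeasure (density_measure (void_law mu \x void_law P)%E w0 mw)
    (measurable_splice hX bV mLam).

Lemma integral_dlr_measure (H : Void R X -> \bar R) :
  measurable_fun setT H -> (forall g, 0 <= H g) ->
  \int[dlr_measure]_g H g =
  \int[void_law mu]_g \int[void_law P]_g' (H (splice Lam g g') * w (g, g')).
Proof.
move=> mH H0.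
have mHs : measurable_fun setT (fun z : Void R X * Void R X => H
  (splice Lam z.1 z.2)).
  exact: (measurableT_comp mH (measurable_splice hX bV mLam)).
rewrite integral_pushmeasure// integral_density//.
rewrite fubini_tonelli1//; first exact: emeasurable_funM.
by move=> z; rewrite mule_ge0.
Qed.

Lemma dlr_measureE A : measurable A -> dlr_measure A = void_law mu A.
Proof.
move=> mA; rewrite -[A]setIT -integral_indic// integral_dlr_measure//; last first.
  by apply/measurable_EFinP; exact: measurable_indic.
have mspec g : measurable_fun setT (fun g' : Void R X =>
    (\1_A (splice Lam g g'))%:E * boltzmann (splice Lam g g')).
  apply: emeasurable_funM.
    apply/measurable_EFinP; apply: (measurableT_comp _ (splice_section g)).
    exact: measurable_indic.
  exact: (measurableT_comp measurable_boltzmann (splice_section g)).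
have spec0 g g' : 0 <= (\1_A (splice Lam g g'))%:E * boltzmann (splice Lam g g').
  by rewrite mule_ge0// ?lee_fin//; exact: expeR_ge0.
have specE g : \int[void_law P]_g' ((\1_A (splice Lam g g'))%:E * w (g, g')) =
    specification Phi P Lam g A.
  rewrite /specification -integral_void_law//.
  rewrite -ge0_integralZl_EFin//; last exact: normalization_ge0.
  by apply: eq_integral => g' _; rewrite /w /= muleCA.
transitivity (\int[void_law mu]_g specification Phi P Lam g A).
  by apply: eq_integral => g _; exact: specE.
rewrite integral_void_law.
- rewrite muP//.
    by rewrite setIT.
  by rewrite -[A]setTI; exact: (measurable_Gamma_Void measurableT mA).
- rewrite (_ : (fun g => _) = fun g => \int[void_law P]_g'
    ((\1_A (splice Lam g g'))%:E * w (g, g'))); last first.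
    by apply/funext => g; rewrite specE.
  apply: (measurable_fun_fubini_tonelli_F (fun z : Void R X * Void R X =>
    (\1_A (splice Lam z.1 z.2))%:E * w z)).
    apply: emeasurable_funM => //; apply/measurable_EFinP.
    by apply: (measurableT_comp _ (measurable_splice hX bV mLam));
      exact: measurable_indic.
  by move=> z; rewrite mule_ge0// lee_fin.
- move=> g; rewrite -specE integral_ge0// => g' _.
  by rewrite mule_ge0// lee_fin.
Qed.

(** The DLR equations say that resampling preserves μ; they hold for events, and
here for integrals of nonnegative functions. *)
Lemma dlr (H : Void R X -> \bar R) :
  measurable_fun setT H -> (forall g, 0 <= H g) ->
  \int[void_law mu]_g H g =
  \int[void_law mu]_g \int[void_law P]_g' (H (splice Lam g g') * w (g, g')).
Proof.
move=> mH H0; rewrite -integral_dlr_measure//.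
by apply: eq_measure_integral => A mA _; rewrite dlr_measureE.
Qed.

Lemma splice_add_point (g g' : configuration R X) x : Lam x ->
  splice Lam g (add_point g' x) = add_point (splice Lam g g') x.
Proof.
move=> Lx; apply: eq_configuration; apply/seteqP; split=> y /=.
  by case=> [[gy Ly]|[[gy|->] Ly]]; [left; left|left; right|right].
by case=> [[[gy Ly]|[gy Ly]]|->]; [left|right; split => //; left|right;
  split => //; right].
Qed.

(** By [dlr] on both sides it suffices to compare the inner integrals over γ' for a
fixed boundary condition γ.  On the left the points in Λ are those of γ', and
[mecke] adds one of them at random; the weight [w] then acquires exactly the
factor given by [boltzmann_add_point]. *)
Theorem gnz (h : Void R X * borel X -> \bar R) :
  measurable_fun setT h -> (forall z, 0 <= h z) ->
  (forall g x, ~ Lam x -> h (g, x) = 0) ->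
  \int[void_law mu]_g \int[config_measure g]_x h (g, x) =
  \int[void_law mu]_g \int[sigma]_x
    (h (add_point g x, x) * expeR (- energy Phi [set x] (add_point g x))).
Proof.
move=> mh h0 hLam.
pose e (z : Void R X * borel X) := expeR (- energy Phi [set z.2]
  (add_point z.1 z.2)).
have me : measurable_fun setT e.
  apply: (measurableT_comp (@measurable_expeR R)).
  apply: (measurableT_comp (@oppe_measurable R setT)).
  exact: (measurable_energy_point hX bV PhiP).
have e0 z : 0 <= e z by exact: expeR_ge0.
pose h' (z : Void R X * borel X) := h (add_point z.1 z.2, z.2).
have mh' : measurable_fun setT h'.
  apply: (measurableT_comp mh); apply: measurable_fun_pair => //.
  exact: (measurable_add_point hX bV).
have h'0 z : 0 <= h' z by exact: h0.
have mhe : measurable_fun setT (fun z => h' z * e z) by exact: emeasurable_funM.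
have he0 z : 0 <= h' z * e z by rewrite mule_ge0.
rewrite dlr; last 2 first.
- exact: (measurable_integral_config hX bV (@measurable_id _ (Void R X) setT) mh
    h0).
- by move=> g; exact: integral_ge0.
rewrite [RHS]dlr; last 2 first.
- exact: (measurable_fun_fubini_tonelli_F (fun z => h' z * e z) mhe he0).
- by move=> g; apply: integral_ge0 => x _; exact: (he0 (g, x)).
apply: eq_integral => g _.
pose k (z : Void R X * borel X) := h (splice Lam g z.1, z.2) * w (g, z.1).
have mk : measurable_fun setT k.
  apply: emeasurable_funM.
    apply: (measurableT_comp mh); apply: measurable_fun_pair => //.
    by apply: (measurableT_comp (splice_section g)).
  by apply: (measurableT_comp (measurable_fun_pair2 (g : Void R X) mw)).
have k0 z : 0 <= k z by rewrite mule_ge0.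
transitivity (\int[void_law P]_g' \int[config_measure g']_x k (g', x)).
  apply: eq_integral => g' _; rewrite -ge0_integralZr//; last first.
    exact: (measurable_fun_pair2 (splice Lam g g' : Void R X) mh).
  rewrite [LHS](integral_config_measure hX bV); last 2 first.
  - apply: emeasurable_funM; last exact: measurable_cst.
    exact: (measurable_fun_pair2 (splice Lam g g' : Void R X) mh).
  - by move=> x; rewrite mule_ge0.
  rewrite [RHS](integral_config_measure hX bV); last 2 first.
  - exact: (measurable_fun_pair2 (g' : Void R X) mk).
  - by move=> x; exact: k0.
  rewrite esum_mkcond [RHS]esum_mkcond; apply: eq_esum => x _.
  rewrite /k /=; have [Lx|Lx] := pselect (Lam x); last first.
    by rewrite hLam// mul0e; case: ifP; case: ifP.
  have [gx|gx] := pselect (points g' x).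
    by rewrite !mem_set//=; right.
  by rewrite (memNset gx) memNset// => -[[_ /(_ Lx)]|[/gx]].
rewrite (mecke hX bV PP)//; apply: eq_integral => g' _.
rewrite -ge0_integralZr; last 4 first.
- exact: measurableT.
- exact: (measurable_fun_pair2 (splice Lam g g' : Void R X) mhe).
- by move=> x _; exact: (he0 (_, x)).
- exact: w0.
apply: ge0_ae_eq_integral => //.
- apply: (measurableT_comp mk); apply: measurable_fun_pair => //.
  exact: (measurable_fun_pair2 (g' : Void R X) (measurable_add_point hX bV)).
- apply: emeasurable_funM; last exact: measurable_cst.
  exact: (measurable_fun_pair2 (splice Lam g g' : Void R X) mhe).
- by move=> x _; rewrite mule_ge0//; exact: (he0 (_, x)).
apply: negligibleS (configuration_negligible (splice Lam g g')) => x /=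
  /not_implyP[_ nx].
apply: contrapT => gx; apply: nx.
rewrite /k /h' /e /=; have [Lx|Lx] := pselect (Lam x); last first.
  by rewrite !hLam// !mul0e.
rewrite splice_add_point// -muleA; congr (_ * _).
rewrite /w /= splice_add_point// /boltzmann boltzmann_add_point//.
by rewrite muleA muleC.
Qed.

End fixed_volume.

End gnz.

(** * Gradients of cylinder functions *)

Section cylinder_gradients.
Context {R : realType} {X : ptopologicalType} {d : nat}.
Variable M : oriented_riemannian R X d.
Variables (V : nat -> set X) (bV : cozero_base (R:=R) V).
Implicit Types (F G : cylinder M) (g : configuration R X).

Definition test_Cc f (tf : test_function M f) : Cc R X :=
  CcFun (smooth_continuous tf.1) tf.2.

(** Near a point outside γ, which is closed, adding [z] to γ shifts the i-th
coordinate of the cylinder function by φ_i(z), so the chain rule applies. *)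
Lemma gradient_poisson_gradient F g x : ~ points g x ->
  gradient M (poisson_gradient (cyl_fun F) g) x =
  intrinsic_gradient F (add_point g x) x.
Proof.
move=> gx; rewrite /gradient /intrinsic_gradient.
have cx := chart_atP M x; set c := M (chart_at M x) in cx *.
set y := cmap c x; have cy : crange c y by exact: cmap_range.
pose u z : 'rV[R]_(cyl_size F) :=
  \row_i (pairing g (cyl_phi i) + (@cyl_phi _ _ _ _ F i \o cinv c) z).
have tphi i := @cyl_phi_test _ _ _ _ F i.
have add z : ~ points g z -> cyl_coord F (add_point g z) =
    \row_i (pairing g (@cyl_phi _ _ _ _ F i) + @cyl_phi _ _ _ _ F i z).
  by move=> gz; apply/rowP => i; rewrite !mxE
    (pairing_add_point (test_Cc (tphi i)) gz).
have near_g : \forall z \near y, ~ points g (cinv c z).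
  have : nbhs (cinv c y) (~` points g).
    rewrite /y cmapK//; apply: open_nbhs_nbhs; split => //.
    apply: closed_openC.
    exact: closed_configuration (manifold_hausdorff M) _ bV g.
  by move=> /(cinv_continuous cy).
have e : {near y, poisson_gradient (cyl_fun F) g \o cinv c =1
    (fun z => cyl_g (u z) - cyl_fun F g)}.
  near=> z; rewrite /poisson_gradient /cyl_fun /= add//.
  by near: z.
have dphi i : differentiable (@cyl_phi _ _ _ _ F i \o cinv c) y.
  exact: (smooth_on_differentiable (@crange_open _ _ _ c) ((tphi i).1 _) cy).
have uE i : (fun z => u z 0 i) = cst (pairing g (@cyl_phi _ _ _ _ F i)) +
  (@cyl_phi _ _ _ _ F i \o cinv c).
  by apply/funext => z; rewrite mxE.
have du i : differentiable (fun z => u z 0 i) y.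
  by rewrite uE; apply: differentiableD.
have dg : differentiable (@cyl_g _ _ _ _ F) (u y).
  exact: (smooth_on_differentiable openT (@cyl_g_smooth _ _ _ _ F).1).
have uy : u y = cyl_coord F (add_point g x).
  by rewrite add//; apply/rowP => i; rewrite !mxE /= /y cmapK.
have -> : \row_j partial j (poisson_gradient (cyl_fun F) g \o cinv c) y =
    \sum_i partial i (@cyl_g _ _ _ _ F) (u y) *: \row_j partial j
      (@cyl_phi _ _ _ _ F i \o cinv c) y.
  apply/rowP => j; rewrite mxE summxE /partial (near_eq_derive _ e).
  have dgu : derivable (fun z => cyl_g (u z)) y (delta_mx 0 j).
    apply: diff_derivable; apply: (@differentiable_comp _ _ _ _ u
      (@cyl_g _ _ _ _ F)) => //.
    exact: differentiable_rV.
  rewrite deriveB; [|exact: dgu|exact: derivable_cst].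
  rewrite derive_cst subr0 derive_comp_rV//; apply: eq_bigr => i _.
  rewrite !mxE uE mulrC; congr (_ * _).
  rewrite deriveD; [|exact: derivable_cst|exact: diff_derivable].
  by rewrite derive_cst add0r.
rewrite mulmx_suml uy; apply: eq_bigr => i _.
by rewrite -scalemxAl.
Unshelve. all: by end_near. Qed.

End cylinder_gradients.

Lemma continuous_compact_bounded (R : realType) (T : topologicalType) (f : T -> R)
  (K : set T) : continuous f -> compact K ->
  exists2 C, 0 <= C & forall x, K x -> `|f x| <= C.
Proof.
move=> cf cK; have [->|/set0P K0] := eqVneq K set0; first by exists 0.
have cn : continuous (fun x => `|f x|).
  by move=> x; apply: (@cvg_norm R R _ (nbhs x)); exact: cf.
have [c _ hc] := compact_EVT_max K0 cK (continuous_subspaceT cn).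
by exists `|f c| => // x Kx; apply: hc; exact/mem_set.
Qed.

Section gradient_inner.
Context {R : realType} {X : ptopologicalType} {d : nat}.
Variable M : oriented_riemannian R X d.
Implicit Types (F G : cylinder M) (g : configuration R X).

Definition gradient_inner F G g x : R :=
  tangent_inner M (intrinsic_gradient F g x) (intrinsic_gradient G g x).

Let phi F (i : 'I_(cyl_size F)) : X -> R := @cyl_phi _ _ _ _ F i.
Let dg F (i : 'I_(cyl_size F)) g : R := partial i (@cyl_g _ _ _ _ F)
  (cyl_coord F g).

Lemma gradient_innerE F G g x : gradient_inner F G g x =
  \sum_i \sum_j (dg i g * dg j g *
    tangent_inner M (gradient M (@phi F i) x) (gradient M (@phi G j) x)).
Proof.
rewrite /gradient_inner /tangent_inner /intrinsic_gradient.
rewrite !mulmx_suml summxE; apply: eq_bigr => i _.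
rewrite linear_sum mulmx_sumr summxE; apply: eq_bigr => j _.
by rewrite linearZ /= -!scalemxAl -scalemxAr !mxE mulrA.
Qed.

Definition cylinder_support F : set X :=
  \big[setU/set0]_(i < cyl_size F) closure [set x | phi i x != 0].

Lemma compact_cylinder_support F : compact (cylinder_support F).
Proof.
apply: big_ind; first exact: compact0.
  exact: compactU.
by move=> i _; have [] := @cyl_phi_test _ _ _ _ F i.
Qed.

(** Bounded derivatives of the outer functions and compact supports of the inner
ones; the first moment condition on μ then makes the form finite. *)
Lemma gradient_inner_bound F G : exists2 C, 0 <= C &
  forall g x, `|gradient_inner F G g x| <= C * \1_(cylinder_support F) x.
Proof.
have bdg H (i : 'I_(cyl_size H)) : exists C : R, forall g, `|dg i g| <= C.
  by have [C HC] := (@cyl_g_smooth _ _ _ _ H).2 [:: i]; exists C => g; exact: HC.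
have [a Ha] := choice (@bdg F); have [b Hb] := choice (@bdg G).
have /choice[c Hc] (ij : 'I_(cyl_size F) * 'I_(cyl_size G)) : exists C : R,
  forall x,
   `|tangent_inner M (gradient M (phi ij.1) x) (gradient M (phi ij.2) x)| <=
     C * \1_(cylinder_support F) x.
  have [sF kF] := @cyl_phi_test _ _ _ _ F ij.1;
    have [sG _] := @cyl_phi_test _ _ _ _ G ij.2.
  have [C C0 HC] := continuous_compact_bounded (continuous_gradient_inner sF sG) kF.
  exists C => x; have [Kx|Kx] := pselect (closure [set z | phi ij.1 z != 0] x).
    rewrite indicE mem_set ?mulr1; first exact: HC.
    by rewrite /cylinder_support (bigD1 ij.1)//=; left.
  by rewrite (gradient_support M Kx) /tangent_inner !mul0mx mxE normr0 mulr_ge0.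
pose C := \sum_i \sum_j `|a i * b j * c (i, j)|.
exists C; first by apply: sumr_ge0 => i _; exact: sumr_ge0.
move=> g x; rewrite gradient_innerE /C mulr_suml.
apply: (le_trans (ler_norm_sum _ _ _)); apply: ler_sum => i _.
rewrite mulr_suml; apply: (le_trans (ler_norm_sum _ _ _)); apply: ler_sum => j _.
have a0 : 0 <= a i by apply: le_trans (Ha i g).
have b0 : 0 <= b j by apply: le_trans (Hb j g).
rewrite !normrM (ger0_norm a0) (ger0_norm b0) -[leRHS]mulrA.
apply: ler_pM => //.
  by apply: ler_pM.
apply: le_trans (Hc (i, j) x) _; rewrite ler_wpM2r//; exact: ler_norm.
Qed.

Lemma gradient_inner0 F G g x : ~ cylinder_support F x -> gradient_inner F G g x
  = 0.
Proof.
move=> Fx; have [C _ /(_ g x)] := gradient_inner_bound F G.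
by rewrite indicE memNset// mulr0 normr_le0 => /eqP.
Qed.

Section measurable.
Hypotheses (hX : hausdorff_space X).
Variables (V : nat -> set X) (bV : cozero_base (R:=R) V).

Lemma measurable_gradient_inner F G : measurable_fun setT
  (fun z : Void R X * borel X => gradient_inner F G z.1 z.2).
Proof.
have mdg H (i : 'I_(cyl_size H)) : measurable_fun setT
  (fun z : Void R X * borel X => dg i z.1).
  apply: (measurable_continuous_rV (c := fun z : Void R X * borel X => cyl_coord
    H z.1)).
    move=> k; under eq_fun do rewrite mxE.
    apply: (measurableT_comp (measurable_pairing_void hX bV
      (test_Cc (@cyl_phi_test _ _ _ _ H k)))).
    exact: measurable_fst.
  move=> y; exact: (smooth_on_continuous (smooth_on_partial i
    (@cyl_g_smooth _ _ _ _ H).1)).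
under eq_fun do rewrite gradient_innerE.
apply: measurable_sum => i; apply: measurable_sum => j.
apply: measurable_funM; first exact: measurable_funM.
apply: (measurableT_comp (f := fun x : borel X => tangent_inner M
  (gradient M (phi i) x) (gradient M (phi j) x))); last exact: measurable_snd.
apply: continuous_borel_measurable; apply: continuous_gradient_inner.
  by have [] := @cyl_phi_test _ _ _ _ F i.
by have [] := @cyl_phi_test _ _ _ _ G j.
Qed.

End measurable.

End gradient_inner.

(** * The intrinsic form of a Gibbs measure *)

Section intensity.
Context {R : realType} {X : ptopologicalType}.
Local Open Scope ereal_scope.

Lemma lebesgue_point n (lam : {measure set (borel 'rV[R]_n.+1) -> \bar R}) y :
  is_lebesgue lam -> measurable ([set y] : set (borel 'rV[R]_n.+1)) /\ lam
    [set y] = 0.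
Proof.
move=> lamP; split.
  rewrite -[[set y]]setCK; apply: measurableC; apply: sub_sigma_algebra.
  apply: closed_openC; apply: compact_closed; first exact: norm_hausdorff.
  exact: compact_set1.
have := lamP y y (fun i => lexx _).
rewrite [X in lam X](_ : _ = [set y]) => [->|].
  by rewrite big_ord_recl subrr mul0r.
apply/seteqP; split=> z /=; last by move=> -> i; rewrite lexx.
move=> h; apply/rowP => i; apply/eqP; rewrite eq_le andbC.
by have := h i.
Qed.

(** σ has a density with respect to the volume, and in positive dimension a chart
sends the volume of a point to the Lebesgue measure of a point. *)
Lemma intensity_point d (M : oriented_riemannian R X d.+1)
  (lam : {measure set (borel 'rV[R]_d.+1) -> \bar R}) (lamP : is_lebesgue lam)
  (m : {measure set (borel X) -> \bar R}) (mP : is_volume M lam m)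
  (rho : X -> R) (sigma : {measure set (borel X) -> \bar R})
  (sigmaP : forall A : set (borel X), measurable A ->
    sigma A = \int[m]_(x in A) (rho x)%:E) x : sigma [set x] = 0.
Proof.
have mx : measurable ([set x] : set (borel X)).
  by apply: measurable_point; exact: manifold_hausdorff M.
rewrite sigmaP// null_set_integral//; first exact: measurable_fun_set1.
have cx := chart_atP M x; set i := chart_at M x in cx.
rewrite (mP i)//; last by move=> z ->.
rewrite (_ : _ `&` _ = [set cmap (M i) x]).
  have [my y0] := lebesgue_point (cmap (M i) x) lamP.
  by rewrite null_set_integral//; exact: measurable_fun_set1.
apply/seteqP; split=> y /=; first by move=> [cy <-]; rewrite cinvK.
by move=> ->; split; [exact: cmap_range|rewrite cmapK].
Qed.

End intensity.

Local Open Scope ereal_scope.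

Lemma funepos_mulr (R : realType) (T : Type) (f e : T -> \bar R) x :
  0 <= e x -> (fun x => f x * e x)^\+ x = f^\+ x * e x.
Proof.
move=> e0; rewrite funepos.unlock; have [f0|f0] := leP 0 (f x).
  by rewrite !max_l// mule_ge0.
by rewrite max_r ?mul0e// mule_le0_ge0// ltW.
Qed.

Lemma funeneg_mulr (R : realType) (T : Type) (f e : T -> \bar R) x :
  0 <= e x -> (fun x => f x * e x)^\- x = f^\- x * e x.
Proof.
move=> e0; rewrite -[in RHS]funeposN -funepos_mulr// -funeposN.
by congr (_^\+ x); apply/funext => y /=; rewrite mulNe.
Qed.

Lemma funepos_le_abse (R : realType) (T : Type) (f : T -> \bar R) x :
  f^\+ x <= `|f x|.
Proof. by rewrite funepos.unlock ge_max lee_abs abse_ge0. Qed.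

Lemma funeneg_le_abse (R : realType) (T : Type) (f : T -> \bar R) x :
  f^\- x <= `|f x|.
Proof. by rewrite funeneg.unlock ge_max -abseN lee_abs abse_ge0. Qed.

(** The Poissonian gradients at the points of γ itself follow no formula, and this
is how the right-hand integrand is seen to be measurable nonetheless. *)
Lemma measurable_fun_off_countable d d' (T : measurableType d)
  (T' : measurableType d') (A : set T) (f g : T -> T') :
  (forall t, measurable ([set t] : set T)) -> countable A ->
  (forall x, ~ A x -> f x = g x) -> measurable_fun setT g ->
  measurable_fun setT f.
Proof.
move=> m1 cA fg mg _ Y mY; rewrite setTI.
have mC (B : set T) : B `<=` A -> measurable B.
  by move=> BA; apply: countable_measurable => //;
    exact: sub_countable (subset_card_le BA) cA.
rewrite (_ : f @^-1` Y = (g @^-1` Y `\` A) `|` (A `&` f @^-1` Y)).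
  apply: measurableU; last by apply: mC => x [].
  by apply: measurableD; [rewrite -[_ @^-1` _]setTI; exact: mg|exact: mC].
apply/seteqP; split=> x /=.
  by have [Ax|Ax] := pselect (A x); [right|left; rewrite -fg].
by case=> [[+ Ax]|[]//]; rewrite fg.
Qed.

Section gibbs_form.
Context {R : realType} {X : ptopologicalType} {d : nat}.
Variable M : oriented_riemannian R X d.
Let hX := manifold_hausdorff M.
Variables (V : nat -> set X) (bV : cozero_base (R:=R) V).
Variable sigma : {sigma_finite_measure set (borel X) -> \bar R}.
Hypothesis sigma1 : forall x, sigma [set x] = 0.
Variables (P : probability (Gamma R X) R) (PP : is_poisson sigma P).
Variables (Phi : configuration R X -> \bar R) (PhiP : is_potential Phi).
Variables (mu : probability (Gamma R X) R) (muP : gibbs1 Phi P mu).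
Variables F G : cylinder M.

Let h (z : Void R X * borel X) : \bar R := (gradient_inner F G z.1 z.2)%:E.
Let e (z : Void R X * borel X) : \bar R :=
  expeR (- energy Phi [set z.2] (add_point z.1 z.2)).
Let h' (z : Void R X * borel X) : \bar R := h (add_point z.1 z.2, z.2).

Let mh : measurable_fun setT h.
Proof. by apply/measurable_EFinP; exact: (measurable_gradient_inner hX bV F G). Qed.

Let me : measurable_fun setT e.
Proof.
apply: (measurableT_comp (@measurable_expeR R)).
apply: (measurableT_comp (@oppe_measurable R setT)).
exact: (measurable_energy_point hX bV PhiP).
Qed.

Let e0 z : 0 <= e z. Proof. exact: expeR_ge0. Qed.

Let mh' : measurable_fun setT h'.
Proof.
apply: (measurableT_comp mh); apply: measurable_fun_pair => //.
exact: (measurable_add_point hX bV).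
Qed.

(** The claim for the positive and negative parts of the inner product [h], with the
integrability that is needed to subtract them. *)
Let inner_ge0 (k : Void R X * borel X -> \bar R) :
  measurable_fun setT k -> (forall z, 0 <= k z) ->
  (forall z, k z <= `|h z|) ->
  mu.-integrable setT (fun g : Gamma R X => \int[config_measure g]_x k (g, x)) /\
  \int[mu]_g \int[config_measure g]_x k (g, x) =
  \int[mu]_g \int[sigma]_x (k (add_point g x, x) * e (g, x)) /\
  mu.-integrable setT (fun g : Gamma R X => \int[sigma]_x
    (k (add_point g x, x) * e (g, x))).
Proof.
move=> mk k0 kh.
have [C C0 HC] := gradient_inner_bound F G.
have cK := @compact_cylinder_support _ _ _ M F.
have [U cU KU] := compact_sub_cozero bV cK.
have OU : Oc U by split; [exact: cozero_open cU|exact: cozero_relatively_compact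
  cU].
have mK : measurable (cylinder_support F : set (borel X)).
  rewrite -[X in measurable X]setCK; apply: measurableC; apply: sub_sigma_algebra.
  by apply: closed_openC; exact: compact_closed.
have mA : measurable_fun setT (fun g : Void R X => \int[config_measure g]_x k
  (g, x)).
  exact: (measurable_integral_config hX bV (@measurable_id _ (Void R X) setT) mk
    k0).
pose k' (z : Void R X * borel X) := k (add_point z.1 z.2, z.2).
have mke : measurable_fun setT (fun z => k' z * e z).
  apply: emeasurable_funM => //; apply: (measurableT_comp mk).
  by apply: measurable_fun_pair => //; exact: (measurable_add_point hX bV).
have ke0 z : 0 <= k' z * e z by rewrite mule_ge0//; exact: k0.
have mB : measurable_fun setT (fun g : Void R X => \int[sigma]_x
  (k (add_point g x, x) * e (g, x))).
  exact: (measurable_fun_fubini_tonelli_F (fun z => k' z * e z) mke ke0).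
have A0 g : 0 <= \int[config_measure g]_x k (g, x) by exact: integral_ge0.
have B0 g : 0 <= \int[sigma]_x (k (add_point g x, x) * e (g, x)).
  by apply: integral_ge0 => x _; exact: (ke0 (g, x)).
have mkg g : measurable_fun setT (fun x : borel X => k (g, x)).
  exact: (measurable_fun_pair2 (g : Void R X) mk).
have gnzk := gnz hX bV sigma1 PP PhiP muP.1 OU mk k0.
have AB : \int[mu]_g \int[config_measure g]_x k (g, x) =
    \int[mu]_g \int[sigma]_x (k (add_point g x, x) * e (g, x)).
  rewrite -!integral_void_law//; apply: gnzk => g x Ux.
  apply/eqP; rewrite eq_le k0 andbT; apply: le_trans (kh _) _.
  by rewrite /h /= gradient_inner0 ?normr0// => /KU.
have Afin : \int[mu]_g \int[config_measure g]_x k (g, x) < +oo.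
  apply: (@le_lt_trans _ _ (\int[mu]_g (C%:E * config_measure g
    (cylinder_support F)))).
    rewrite -!integral_void_law//; last 2 first.
    - by apply: emeasurable_funM => //; exact: (measurable_config_measure hX bV).
    - by move=> g; rewrite mule_ge0.
    apply: ge0_le_integral => //.
    - by apply: emeasurable_funM => //; exact: (measurable_config_measure hX bV).
    move=> g _; rewrite -[config_measure g _](_ : \int[config_measure g]_x
      (\1_(cylinder_support F) x)%:E = _); last first.
      by rewrite integral_indic// setIT.
    rewrite -ge0_integralZl_EFin//; last first.
      by apply/measurable_EFinP; exact: measurable_indic.
    apply: ge0_le_integral => //.
    - by apply: emeasurable_funM => //; apply/measurable_EFinP;
        exact: measurable_indic.
    - by move=> x _; apply: le_trans (kh _) _; rewrite /h /= -EFinM lee_fin.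
  rewrite ge0_integralZl_EFin//; last first.
    move=> _ Y mY; rewrite setTI.
    have := measurable_Gamma_Void measurableT
      (measurable_config_measure hX bV mK measurableT mY).
    by rewrite !setTI.
  have := muP.2 _ cK; rewrite ltey => Kfin.
  rewrite lte_mul_pinfty//.
  by rewrite ltey.
have toGamma (u : configuration R X -> \bar R) :
    measurable_fun setT (u : Void R X -> \bar R) -> measurable_fun setT
      (u : Gamma R X -> \bar R).
  by move=> mu'; exact: (measurableT_comp mu' (@measurable_Gamma_Void R X)).
split; [|split=> //].
  apply/integrableP; split; first exact: toGamma.
  by under eq_integral do rewrite gee0_abs//.
apply/integrableP; split; first exact: toGamma.
by under eq_integral do rewrite gee0_abs//; rewrite -AB.
Qed.

Lemma gibbs_intrinsic_form :
  intrinsic_form mu F G =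
  \int[mu]_g \int[sigma]_x
    ((tangent_inner M (gradient M (poisson_gradient (cyl_fun F) g) x)
                      (gradient M (poisson_gradient (cyl_fun G) g) x))%:E
     * expeR (- energy Phi [set x] (add_point g x))).
Proof.
have mhp : measurable_fun setT h^\+ by exact: measurable_funepos mh.
have mhn : measurable_fun setT h^\- by exact: measurable_funeneg mh.
have [iAp [ABp iBp]] := inner_ge0 mhp (funepos_ge0 h)
  (fun z => funepos_le_abse h z).
have [iAn [ABn iBn]] := inner_ge0 mhn (funeneg_ge0 h)
  (fun z => funeneg_le_abse h z).
rewrite /intrinsic_form /config_tangent_inner.
transitivity (\int[mu]_g (\int[config_measure g]_x h^\+ (g, x) -
                          \int[config_measure g]_x h^\- (g, x))).
  apply: eq_integral => g _; rewrite integralE.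
  by congr (_ - _); apply: eq_integral => x _;
    rewrite ?funepos.unlock ?funeneg.unlock.
rewrite (integralB measurableT iAp iAn) ABp ABn.
rewrite -(integralB measurableT iBp iBn).
apply: eq_integral => g _.
transitivity (\int[sigma]_x (h' (g, x) * e (g, x))).
  rewrite [RHS]integralE; congr (_ - _); apply: eq_integral => x _.
    by rewrite (funepos_mulr (fun x => h' (g, x)) (e := fun x => e (g, x)))//
      funepos.unlock.
  by rewrite (funeneg_mulr (fun x => h' (g, x)) (e := fun x => e (g, x)))//
    funeneg.unlock.
have mhe : measurable_fun setT (fun x : borel X => h' (g, x) * e (g, x)).
  by apply: emeasurable_funM; [exact: (measurable_fun_pair2 (g : Void R X)
    mh')|exact: (measurable_fun_pair2 (g : Void R X) me)].
have off x : ~ points g x -> h' (g, x) * e (g, x) =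
    (tangent_inner M (gradient M (poisson_gradient (cyl_fun F) g) x)
                      (gradient M (poisson_gradient (cyl_fun G) g) x))%:E
     * expeR (- energy Phi [set x] (add_point g x)).
  by move=> gx; rewrite !(gradient_poisson_gradient bV).
apply: ae_eq_integral => //.
- apply: (@measurable_fun_off_countable _ _ (borel X) _ (points g)) mhe.
  + by move=> x; exact: measurable_point hX.
  + have [_ _ gsub] := isolated_point_bij hX bV g.
    apply: sub_countable (subset_card_le gsub) _.
    exact: sub_countable (card_image_le _ _) (countableP _).
  + by move=> x gx; rewrite -off.
- apply: negligibleS (configuration_negligible hX bV sigma1 g) => x /=
    /not_implyP[_ nx].
  by apply: contrapT => gx; apply: nx; exact: off.
Qed.

End gibbs_form.

Theorem theorem5p1 (R : realType) (X : ptopologicalType) (d : nat)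
  (M : oriented_riemannian R X d)
  (Xconn : connected [set: X]) (Xnoncompact : ~ compact [set: X])
  (lam : {measure set (borel 'rV[R]_d) -> \bar R}) (lamP : is_lebesgue lam)
  (m : {measure set (borel X) -> \bar R}) (mP : is_volume M lam m)
  (rho : X -> R) (rho_meas : measurable_fun setT (rho : borel X -> R))
  (rho_pos : {ae m, forall x, (0 < rho x)%R})
  (rho_H12 : H12_loc M lam (fun x => Num.sqrt (rho x)))
  (rho_notL1 : ~ m.-integrable setT (fun x : borel X => (rho x)%:E))
  (sigma : {measure set (borel X) -> \bar R})
  (sigmaP : forall A : set (borel X), measurable A ->
    sigma A = \int[m]_(x in A) (rho x)%:E)
  (P : probability (Gamma R X) R) (PP : is_poisson sigma P)
  (Phi : configuration R X -> \bar R) (PhiP : is_potential Phi)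
  (mu : probability (Gamma R X) R) (muP : gibbs1 Phi P mu)
  (F G : cylinder M) :
  intrinsic_form mu F G =
  \int[mu]_gamma \int[sigma]_x
    ((tangent_inner M (gradient M (poisson_gradient (cyl_fun F) gamma) x)
                      (gradient M (poisson_gradient (cyl_fun G) gamma) x))%:E
     * expeR (- energy Phi [set x] (add_point gamma x))).
Proof.
(* In dimension 0 the volume may charge points, but the tangent spaces are
   trivial and both sides vanish. *)
move: M lam lamP mP rho_H12 F G; case: d => [|d] M lam lamP mP _ F G.
  have inner0 x (v w : tangent (R:=R) (d:=0) x) : tangent_inner M v w = 0%R.
    by rewrite /tangent_inner (thinmx0 v) !mul0mx mxE.
  rewrite /intrinsic_form /config_tangent_inner !integral0_eq// => g _.
    by rewrite integral0_eq// => x _; rewrite inner0 mul0e.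
  by rewrite integral0_eq// => x _; rewrite inner0.
have sep : separating R X.
  move=> U p Up; exact: chart_bump (manifold_hausdorff M) (chart_atP M p) Up.
have [V bV] := cozero_baseP sep (manifold_second_countable M).
case: sigma sigmaP PP => s cs sigmaP PP.
pose sf := Measure_isSigmaFinite.Build _ _ _ (Measure.Pack cs)
  (poisson_sigma_finite bV PP).
pose sigma' : {sigma_finite_measure set (borel X) -> \bar R} := HB.pack s cs sf.
exact: (@gibbs_intrinsic_form R X d.+1 M V bV sigma'
  (intensity_point lamP mP sigmaP) P PP Phi PhiP mu muP F G).
Qed.
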